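(* Let $\mathcal{A}$ be a commutative associative algebra with identity $e$, let $\mathcal{B}$ be a Courant $\mathcal{A}$-algebroid, and let $S(\mathcal{C})_{\mathcal{B}}=S(\mathcal{C})/I_{\mathcal{B}}=\coprod_{n\in\mathbb{N}}(S(\mathcal{C})_{\mathcal{B}})_{(n)}$ be the associated $\mathbb{N}$-graded vertex Poisson algebra. Then $(S(\mathcal{C})_{\mathcal{B}})_{(0)}=\mathcal{A}$ and $(S(\mathcal{C})_{\mathcal{B}})_{(1)}=\mathcal{B}$; that is, the natural maps $\mathcal{A}\to(S(\mathcal{C})_{\mathcal{B}})_{(0)}$ and $\mathcal{B}\to(S(\mathcal{C})_{\mathcal{B}})_{(1)}$ sending an element to its class modulo $I_{\mathcal{B}}$ are isomorphisms, the first of commutative associative algebras and the second (via the first) of Courant $\mathcal{A}$-algebroids. Moreover, for any $n\ge1$, $$(S(\mathcal{C})_{\mathcal{B}})_{(n)}=\mathrm{span}_{\mathbb{C}}\{\mathcal{D}^{n_1}(b_1)\cdot\mathcal{D}^{n_2}(b_2)\cdots\mathcal{D}^{n_k}(b_k)\ :\ b_i\in\mathcal{B},\ n_1\ge\dots\ge n_k\ge0,\ k\ge1,\ n_1+\dots+n_k+k=n\}.$$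
   Context: All vector spaces are over $\mathbb{C}$ and $\mathbb{N}=\{0,1,2,\dots\}$. $\mathrm{Der}$ denotes the space of derivations of an algebra. For a formal series $f(x_1,\dots,x_n)=\sum_{m_i\in\mathbb{Z}}u(m_1,\dots,m_n)x_1^{-m_1-1}\cdots x_n^{-m_n-1}$, $\mathrm{Sing}\,f$ denotes the part of the sum with all $m_i\in\mathbb{N}$. Powers $(x_1-x_2)^{-k}$ are expanded in nonnegative powers of $x_2$. A vertex Lie algebra is a vector space $A$ with a linear operator $\partial$ and a linear map $Y_-:A\to\mathrm{Hom}(A,x^{-1}A[x^{-1}])$, $a\mapsto Y_-(a,x)=\sum_{n\in\mathbb{N}}a_nx^{-n-1}$ ($a_n\in\mathrm{End}\,A$), such that for $a,b\in A$: $a_nb=0$ for $n$ sufficiently large; $Y_-(\partial a,x)=\frac{d}{dx}Y_-(a,x)$; $Y_-(a,x)b=\mathrm{Sing}(e^{x\partial}Y_-(b,-x)a)$; $[Y_-(a,x_1),Y_-(b,x_2)]=\mathrm{Sing}(Y_-(Y_-(a,x_1-x_2)b,x_2))$. A differential algebra is a commutative associative algebra with identity $1$ together with a derivation $\partial$. A vertex Poisson algebra is a differential algebra $(A,\partial)$ with a vertex Lie algebra structure $(Y_-,\partial)$ (same $\partial$) such that $a_n(bc)=(a_nb)c+b(a_nc)$ for $a,b,c\in A$, $n\in\mathbb{N}$. It is $\mathbb{N}$-graded if $A=\coprod_{n\in\mathbb{N}}A_{(n)}$ is a grading of $A$ as an algebra and $\partial A_{(r)}\subset A_{(r+1)}$,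 $a_mA_{(r)}\subset A_{(r+n-m-1)}$ for $a\in A_{(n)}$, $m,n,r\in\mathbb{N}$ (where $A_{(k)}=0$ for $k<0$). An ideal of a vertex Poisson algebra $A$ is an ideal $I$ of the associative algebra with $\partial I\subset I$ and $a_nI\subset I$ for $a\in A$, $n\in\mathbb{N}$; $A/I$ is then a vertex Poisson algebra. For an $\mathbb{N}$-graded vertex Poisson algebra $A$, $A_{(1)}$ is a Courant $A_{(0)}$-algebroid with $[u,v]=u_0v$, $\langle u,v\rangle=u_1v$, $\pi(u)(a)=u_0a$ and derivation $\partial|_{A_{(0)}}$. A Leibniz algebra is a vector space with a bilinear bracket satisfying $[u,[v,w]]=[[u,v],w]+[v,[u,w]]$. For a unital commutative associative algebra $\mathcal{A}$, a Leibniz $\mathcal{A}$-algebra is a Leibniz algebra equipped with an $\mathcal{A}$-module structure (e.g. $\mathrm{Der}(\mathcal{A})$); homomorphisms are $\mathcal{A}$-linear Leibniz homomorphisms. A Courant $\mathcal{A}$-algebroid is an $\mathcal{A}$-module $\mathcal{B}$ equipped with a ($\mathbb{C}$-bilinear) Leibniz bracket $[\cdot,\cdot]$, a homomorphism of Leibniz $\mathcal{A}$-algebras $\pi:\mathcal{B}\to\mathrm{Der}(\mathcal{A})$, a symmetric $\mathcal{A}$-bilinear pairing $\langle\cdot,\cdot\rangle:\mathcal{B}\otimes_{\mathcal{A}}\mathcal{B}\to\mathcal{A}$, and a derivation $\partial:\mathcal{A}\to\mathcal{B}$ with $\pi\circ\partial=0$, such that for $a\in\mathcal{A}$, $u,v,w\in\mathcal{B}$: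 $[u,av]=a[u,v]+\pi(u)(a)v$; $\langle[u,v],w\rangle+\langle v,[u,w]\rangle=\pi(u)\langle v,w\rangle$; $[u,\partial a]=\partial(\pi(u)a)$; $\langle u,\partial a\rangle=\pi(u)a$; $[u,v]+[v,u]=\partial\langle u,v\rangle$. An isomorphism of Courant algebroids is a linear isomorphism compatible with the module structures, brackets, pairings, maps $\pi$ and derivations $\partial$. Given a Courant $\mathcal{A}$-algebroid $\mathcal{B}$, put, for $a,a'\in\mathcal{A}$, $u,v\in\mathcal{B}$: $a_ia'=0$ ($i=0,1$), $u_0v=[u,v]$, $u_1v=\langle u,v\rangle$, $u_0a=\pi(u)(a)$, $a_0u=-u_0a$. (This makes $\mathcal{A}\oplus\mathcal{B}$ a so-called 1-truncated conformal algebra.) Construction of $\mathcal{C}$. Put $C(\mathcal{A}\oplus\mathcal{B})=\mathbb{C}[\mathcal{D}]\otimes(\mathcal{A}\oplus\mathcal{B})$ with $\mathcal{D}$ a formal variable and tensor product over $\mathbb{C}$, $C(\mathcal{A})=\mathbb{C}[\mathcal{D}]\otimes\mathcal{A}$, identify $u\in\mathcal{A}\oplus\mathcal{B}$ with $1\otimes u$, let $\mathcal{D}(\mathcal{D}^n\otimes u)=\mathcal{D}^{n+1}\otimes u$, and let $\hat\partial:C(\mathcal{A})\to C(\mathcal{A}\oplus\mathcal{B})$, $\hat\partial(\mathcal{D}^n\otimes a)=\mathcal{D}^n\otimes\partial a-\mathcal{D}^{n+1}\otimes a$. Grade $C(\mathcal{A}\oplus\mathcal{B})$ by $\deg(\mathcal{D}^n\otimes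 a)=n$ for $a\in\mathcal{A}$ and $\deg(\mathcal{D}^n\otimes b)=n+1$ for $b\in\mathcal{B}$. Define the linear map $Y^0_-:C(\mathcal{A}\oplus\mathcal{B})\to\mathrm{Hom}(C(\mathcal{A}\oplus\mathcal{B}),x^{-1}C(\mathcal{A}\oplus\mathcal{B})[x^{-1}])$, $Y^0_-(u,x)=\sum_{n\in\mathbb{N}}u_nx^{-n-1}$, by: for $a,a'\in\mathcal{A}$, $b,b'\in\mathcal{B}$, $u,v\in\mathcal{A}\oplus\mathcal{B}$, $n\ge1$, $m\in\mathbb{N}$, $Y^0_-(a,x)a'=0$; $Y^0_-(a,x)b=a_0b\,x^{-1}$; $Y^0_-(b,x)a=b_0a\,x^{-1}$; $Y^0_-(b,x)b'=b_0b'x^{-1}+b_1b'x^{-2}$; $Y^0_-(u,x)e^{x_1\mathcal{D}}v=e^{x_1\mathcal{D}}e^{-x_1\frac{d}{dx}}Y^0_-(u,x)v$ (with $x_1$ a formal variable); $Y^0_-(\mathcal{D}^n\otimes u,x)(\mathcal{D}^m\otimes v)=\mathrm{Sing}\big(e^{x\mathcal{D}}(-\tfrac{d}{dx})^mY^0_-(v,-x)(\mathcal{D}^n\otimes u)\big)$. The subspace $\hat\partial C(\mathcal{A})$ is graded, $\mathcal{D}$-stable and a two-sided ideal for all the products $u_nv$, so $\mathcal{D}$, $Y^0_-$ and the grading descend to $\mathcal{C}=C(\mathcal{A}\oplus\mathcal{B})/\hat\partial C(\mathcal{A})$, which is a vertex Lie algebra. The image of $\mathcal{D}^n\otimes u$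 in $\mathcal{C}$ is written $\mathcal{D}^nu$. $S(\mathcal{C})$ is the symmetric algebra over $\mathcal{C}$ (product denoted $\cdot$, identity $1$), with $\mathcal{D}$ extended to a derivation and the grading induced from $\mathcal{C}$. It is an $\mathbb{N}$-graded vertex Poisson algebra with $Y_-$ as follows: for $u\in\mathcal{C}$, $\widetilde{Y^0_-}(u,x)\in x^{-1}(\mathrm{Der}\,S(\mathcal{C}))[[x^{-1}]]$ is the unique element with $\widetilde{Y^0_-}(u,x)v=Y^0_-(u,x)v$ for $v\in\mathcal{C}$; for $a\in S(\mathcal{C})$, $Y_-(a,x)\in x^{-1}(\mathrm{Der}\,S(\mathcal{C}))[[x^{-1}]]$ is determined by $Y_-(a,x)u=\mathrm{Sing}(e^{x\mathcal{D}}\widetilde{Y^0_-}(u,-x)a)$ for $u\in\mathcal{C}$. One has $Y_-(u,x)=\widetilde{Y^0_-}(u,x)$ for $u\in\mathcal{C}$. Let $E_0=\mathrm{span}\{e-1,\ a\cdot a'-aa' : a,a'\in\mathcal{A}\}\subset S(\mathcal{C})_{(0)}$, $E_1=\mathrm{span}\{a\cdot b-ab : a\in\mathcal{A},b\in\mathcal{B}\}\subset S(\mathcal{C})_{(1)}$ (where $aa'$ and $ab$ are the product in $\mathcal{A}$ and the $\mathcal{A}$-action on $\mathcal{B}$), $E=E_0\oplus E_1$, $\mathbb{C}[\mathcal{D}](E)=\mathrm{span}\{\mathcal{D}^m(u): u\in E, m\in\mathbb{N}\}$ and $I_{\mathcal{B}}=S(\mathcal{C})\cdot\mathbb{C}[\mathcal{D}](E)$.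 $I_{\mathcal{B}}$ is a graded ideal of the vertex Poisson algebra $S(\mathcal{C})$, and $S(\mathcal{C})_{\mathcal{B}}=S(\mathcal{C})/I_{\mathcal{B}}$. *)

(* Defs.v *)
From HB Require Import structures.
From mathcomp Require Import all_boot all_order all_algebra.
From mathcomp Require Import mathcomp_extra boolp classical_sets functions.
From mathcomp Require Import cardinality fsbigop.
From mathcomp Require Import monalg.

Set Implicit Arguments.
Unset Strict Implicit.
Unset Printing Implicit Defensive.

Import GRing.Theory.
Local Open Scope classical_set_scope.
Local Open Scope ring_scope.
Local Open Scope quotient_scope.

(* Commutative associative unital algebras, the zero algebra included: the
   library's comAlgType requires 1 != 0. *)
Record comPzAlg (K : fieldType) := ComPzAlg {
  cpa_mod : lmodType K;
  cpa_one : cpa_mod;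
  cpa_mul : cpa_mod -> cpa_mod -> cpa_mod;
  cpa_mulA : associative cpa_mul;
  cpa_mulC : commutative cpa_mul;
  cpa_mul1 : left_id cpa_one cpa_mul;
  cpa_mulDl : left_distributive cpa_mul +%R;
  cpa_scaleAl : forall (k : K) x y, k *: cpa_mul x y = cpa_mul (k *: x) y
}.
Definition cpa_sort (K : fieldType) (A : comPzAlg K) : Type := cpa_mod A.
Coercion cpa_sort : comPzAlg >-> Sortclass.
HB.instance Definition _ (K : fieldType) (A : comPzAlg K) :=
  GRing.Lmodule.on (cpa_sort A).
HB.instance Definition _ (K : fieldType) (A : comPzAlg K) :=
  GRing.Zmodule_isComPzRing.Build (cpa_sort A)
    (@cpa_mulA K A) (@cpa_mulC K A) (@cpa_mul1 K A) (@cpa_mulDl K A).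

Section Span.
Variables (K : fieldType) (V : lmodType K) (E : set V).

Definition lspan : {pred V} := fun x =>
  `[< exists2 s : seq (K * V),
        forall p, p \in s -> E p.2 & x = \sum_(p <- s) p.1 *: p.2 >].

Lemma lspan_submod : subsemimod_closed lspan.
Proof.
split; first split; first by apply/asboolP; exists [::] => //; rewrite big_nil.
  move=> x y /asboolP[s sE ->] /asboolP[t tE ->]; apply/asboolP.
  exists (s ++ t); last by rewrite big_cat.
  by move=> p; rewrite mem_cat => /orP[/sE|/tE].
move=> k x /asboolP[s sE ->]; apply/asboolP.
exists [seq (k * p.1, p.2) | p <- s]; first by move=> p /mapP[q /sE Eq ->].
by rewrite big_map scaler_sumr; apply: eq_bigr => p _; rewrite scalerA.
Qed.

HB.instance Definition _ := GRing.isSubmodClosed.Build K V lspan lspan_submod.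
End Span.

(* V / span E *)
Definition quotlmod (K : fieldType) (V : lmodType K) (E : set V) :=
  {ideal_quot (lspan E)}.

Section QuotientModule.
Variables (K : fieldType) (V : lmodType K) (E : set V).
Local Notation W := (lspan E).
Local Notation Q := (quotlmod E).

HB.instance Definition _ := GRing.Zmodule.on Q.
HB.instance Definition _ := EqQuotient.on Q.

Lemma quot_eqP (x y : V) : reflect (\pi_Q x = \pi_Q y) (x - y \in W).
Proof. by rewrite Quotient.idealrBE; apply: eqP. Qed.

Lemma quot_reprP (x : V) : repr (\pi_Q x) - x \in W.
Proof. by apply/quot_eqP; rewrite reprK. Qed.

Lemma pi_quot0 : \pi_Q 0 = 0.
Proof. exact: (raddf0 (\pi_({ideal_quot W}))). Qed.

Lemma pi_quotD (x y : V) : \pi_Q (x + y) = \pi_Q x + \pi_Q y.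
Proof. exact: (raddfD (\pi_({ideal_quot W}))). Qed.

Definition qscale (k : K) (x : Q) : Q := \pi_Q (k *: repr x).

Lemma pi_qscale k (x : V) : \pi_Q (k *: x) = qscale k (\pi_Q x).
Proof. by apply/esym/quot_eqP; rewrite -scalerBr rpredZ ?quot_reprP. Qed.

Lemma qscaleA k l x : qscale k (qscale l x) = qscale (k * l) x.
Proof. by rewrite -[x]reprK -(pi_qscale l) -!pi_qscale scalerA. Qed.
Lemma qscale1 : left_id 1 qscale.
Proof. by move=> x; rewrite /qscale scale1r reprK. Qed.
Lemma qscaleDr : right_distributive qscale +%R.
Proof.
by move=> k x y; rewrite -[x]reprK -[y]reprK -pi_quotD -!pi_qscale scalerDr
  pi_quotD.
Qed.
Lemma qscaleDl x : {morph qscale^~ x : k l / k + l}.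
Proof. by move=> k l; rewrite -[x]reprK -!pi_qscale scalerDl pi_quotD. Qed.

HB.instance Definition _ :=
  GRing.Zmodule_isLmodule.Build K Q qscaleA qscale1 qscaleDr qscaleDl.
End QuotientModule.

Section Ideal.
Variables (K : fieldType) (S : comAlgType K) (E : set S).

(* The ideal generated by E, as the subspace S.E *)
Definition ideal_gen : set S := [set x * y | x in [set: S] & y in E].

Lemma ideal_absorb (x y : S) :
  y \in lspan ideal_gen -> x * y \in lspan ideal_gen.
Proof.
move=> /asboolP[s sE ->]; apply/asboolP.
exists [seq (p.1, x * p.2) | p <- s].
  move=> p /mapP[q /sE/= [z _ [t Et ztE]] ->] /=.
  by exists (x * z) => //; exists t; rewrite // -ztE mulrA.
by rewrite big_map mulr_sumr; apply: eq_bigr => p _; rewrite scalerAr.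
Qed.

Definition quotalg := quotlmod ideal_gen.
End Ideal.

Section QuotientAlgebra.
Variables (K : fieldType) (S : comAlgType K) (E : set S).
Local Notation Q := (quotalg E).

HB.instance Definition _ := GRing.Lmodule.on Q.
HB.instance Definition _ := EqQuotient.on Q.

Definition qone : Q := \pi_Q 1.
Definition qmul (x y : Q) : Q := \pi_Q (repr x * repr y).

Lemma pi_qmul (x y : S) : \pi_Q (x * y) = qmul (\pi_Q x) (\pi_Q y).
Proof.
apply/esym/quot_eqP; set x' := repr _; set y' := repr _.
have -> : x' * y' - x * y = x' * (y' - y) + y * (x' - x).
  by rewrite !mulrBr [y * x']mulrC [y * x]mulrC addrA subrK.
by rewrite rpredD ?ideal_absorb // quot_reprP.
Qed.

Lemma qmulA : associative qmul.
Proof.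
move=> x y z; rewrite -[x]reprK -[y]reprK -[z]reprK.
rewrite -(pi_qmul (repr y)) -(pi_qmul (repr x) (repr y)).
by rewrite -(pi_qmul (repr x)) -(pi_qmul (_ * _)) mulrA.
Qed.
Lemma qmulC : commutative qmul.
Proof. by move=> x y; rewrite /qmul mulrC. Qed.
Lemma qmul1 : left_id qone qmul.
Proof. by move=> x; rewrite -[x]reprK -pi_qmul mul1r. Qed.
Lemma qmulDl : left_distributive qmul +%R.
Proof.
move=> x y z; rewrite -[x]reprK -[y]reprK -[z]reprK.
rewrite -(pi_quotD (ideal_gen E) (repr x)) -(pi_qmul (_ + _)).
by rewrite -(pi_qmul (repr x)) -(pi_qmul (repr y)) -(pi_quotD (ideal_gen E))
  mulrDl.
Qed.

HB.instance Definition _ :=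
  GRing.Zmodule_isComPzRing.Build Q qmulA qmulC qmul1 qmulDl.

Lemma qscaleAl (k : K) (x y : Q) : k *: (x * y) = (k *: x) * y.
Proof.
rewrite -[x]reprK -[y]reprK -[_ * _]pi_qmul -[k *: \pi_Q (_ * _)]pi_qscale.
by rewrite scalerAl -[k *: \pi_Q _]pi_qscale -[RHS]pi_qmul.
Qed.
End QuotientAlgebra.

(* The symmetric algebra of V: the polynomial algebra K[x_v : v in V] modulo
   the linear relations between the variables x_v. *)
Section SymmetricAlgebra.
Variables (K : fieldType) (V : lmodType K).

Definition symvar (v : V) : {malg K[{cmonom V}]} := << ucm v >>.

Definition symrel : set {malg K[{cmonom V}]} :=
  [set p | exists k u v,
     p = symvar (k *: u + v) - (k *: symvar u + symvar v)].

Definition symalg := quotalg symrel.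

HB.instance Definition _ := GRing.ComPzRing.on symalg.
HB.instance Definition _ := GRing.Lmodule.on symalg.
HB.instance Definition _ := EqQuotient.on symalg.

Lemma symvar_const (v : V) : mcoeff mone (symvar v) = 0.
Proof.
rewrite /symvar mcoeffU; case: eqP => // /eqP/cmP/(_ v).
by rewrite ucmE eqxx onecmE.
Qed.

Lemma symrel_const p : symrel p -> mcoeff mone p = 0.
Proof.
move=> [k [u [v ->]]].
move: (symvar_const (k *: u + v)) (symvar_const u) (symvar_const v).
move: (symvar (k *: u + v)) (symvar u) (symvar v) => x y z x0 y0 z0.
by rewrite mcoeffB mcoeffD mcoeffZ x0 y0 z0 mulr0 addr0 subr0.
Qed.

Lemma sym_oner_neq0 : (1 : symalg) != 0.
Proof.
apply/eqP => e10.
have /(introT (quot_eqP (ideal_gen symrel) 1 0)) :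
    \pi_(quotlmod (ideal_gen symrel)) 1 = \pi_(quotlmod (ideal_gen symrel)) 0.
  by rewrite pi_quot0; exact: e10.
rewrite /lspan => /asboolP[s sE].
rewrite subr0 => /(congr1 (mcoeff mone)); rewrite rmorph1 raddf_sum /= => e.
move: (oner_neq0 K); rewrite e big1_seq ?eqxx// => p /andP[_ /sE].
by move=> [x _ [y /symrel_const y0 <-]]; rewrite mcoeffZ rmorphM/= y0 !mulr0.
Qed.

HB.instance Definition _ :=
  GRing.PzSemiRing_isNonZero.Build symalg sym_oner_neq0.
HB.instance Definition _ :=
  GRing.Lmodule_isLalgebra.Build K symalg (@qscaleAl _ _ symrel).
HB.instance Definition _ := GRing.Lalgebra_isComAlgebra.Build K symalg.

Definition sym_inj (v : V) : symalg := \pi_symalg (symvar v).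

Definition is_derivation (d : symalg -> symalg) :=
  (forall (k : K) x y, d (k *: x + y) = k *: d x + d y) /\
  (forall x y, d (x * y) = d x * y + x * d y).

(* The unique derivation of S(V) extending a linear map f : V -> S(V) *)
Definition der_ext (f : V -> symalg) : symalg -> symalg :=
  xget (fun=> 0) [set d | is_derivation d /\ forall v, d (sym_inj v) = f v].

End SymmetricAlgebra.

(* C[D] (x) V, as finitely supported sequences: f stands for the sum of the
   D^n (x) f n. *)
Section DPolynomials.
Variables (K : fieldType) (V : lmodType K).

Definition fin_supp : {pred nat -> V} := fun f =>
  `[< exists N, forall n, (N <= n)%N -> f n = 0 >].

Lemma fin_supp_submod : subsemimod_closed fin_supp.
Proof.
split; first split; first by apply/asboolP; exists 0.
  move=> f g /asboolP[M fM] /asboolP[N gN]; apply/asboolP.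
  exists (maxn M N) => n; rewrite geq_max => /andP[Mn Nn].
  by rewrite [LHS](_ : _ = f n + g n)// fM ?gN ?addr0.
move=> k f /asboolP[M fM]; apply/asboolP; exists M => n Mn.
by rewrite [LHS](_ : _ = k *: f n)// fM ?scaler0.
Qed.

HB.instance Definition _ :=
  GRing.isSubmodClosed.Build K (nat -> V) fin_supp fin_supp_submod.

Record dpoly := DPoly { dcoef :> nat -> V; _ : dcoef \in fin_supp }.

HB.instance Definition _ := [isSub for dcoef].
HB.instance Definition _ := [Choice of dpoly by <:].
HB.instance Definition _ := [SubChoice_isSubLmodule of dpoly by <:].

Lemma dmon_subproof n (v : V) : (fun k => if k == n then v else 0) \in fin_supp.
Proof.
by apply/asboolP; exists n.+1 => k; case: eqVneq => // ->; rewrite ltnn.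
Qed.
(* D^n (x) v *)
Definition dmon n (v : V) : dpoly := DPoly (dmon_subproof n v).

Lemma dshift_subproof (f : dpoly) :
  (fun k => if k is k'.+1 then f k' else 0) \in fin_supp.
Proof.
have /asboolP[N fN] : dcoef f \in fin_supp by case: f.
by apply/asboolP; exists N.+1 => -[//|k] /fN.
Qed.
(* The operator D *)
Definition dshift (f : dpoly) : dpoly := DPoly (dshift_subproof f).
End DPolynomials.

(* An A-module as a K-vector space *)
Definition restr (K : fieldType) (A : comPzAlg K) (B : lmodType A) : Type := B.

Section RestrictionOfScalars.
Variables (K : fieldType) (A : comPzAlg K) (B : lmodType A).

Definition restr_scale (k : K) (b : restr B) : restr B :=
  (k *: (1 : A)) *: (b : B).

Lemma restr_scaleA k l b :
  restr_scale k (restr_scale l b) = restr_scale (k * l) b.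
Proof.
rewrite /restr_scale scalerA -[_ * _]cpa_scaleAl [cpa_mul _ _]mul1r.
by rewrite scalerA.
Qed.
Lemma restr_scale1 : left_id 1 restr_scale.
Proof. by move=> b; rewrite /restr_scale !scale1r. Qed.
Lemma restr_scaleDr : right_distributive restr_scale +%R.
Proof. by move=> k b c; rewrite /restr_scale scalerDr. Qed.
Lemma restr_scaleDl b : {morph restr_scale^~ b : k l / k + l}.
Proof. by move=> k l; rewrite /restr_scale !scalerDl. Qed.

HB.instance Definition _ := GRing.Zmodule.on (restr B).
HB.instance Definition _ := GRing.Zmodule_isLmodule.Build K (restr B)
  restr_scaleA restr_scale1 restr_scaleDr restr_scaleDl.
End RestrictionOfScalars.

(* The K-action on a module over A is restricted along k |-> k *: 1. *)
Record courant (K : fieldType) (A : comPzAlg K) := Courant {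
  ca_mod :> lmodType A;
  bracket : ca_mod -> ca_mod -> ca_mod;
  anchor : ca_mod -> A -> A;
  pairing : ca_mod -> ca_mod -> A;
  cder : A -> ca_mod;
  bracket_linl : forall (k : K) u v w,
    bracket ((k *: (1 : A)) *: u + v) w =
      (k *: (1 : A)) *: bracket u w + bracket v w;
  bracket_linr : forall (k : K) u v w,
    bracket u ((k *: (1 : A)) *: v + w) =
      (k *: (1 : A)) *: bracket u v + bracket u w;
  bracket_leibniz : forall u v w,
    bracket u (bracket v w) = bracket (bracket u v) w + bracket v (bracket u w);
  anchor_lin : forall u (k : K) a b,
    anchor u (k *: a + b) = k *: anchor u a + anchor u b;
  anchor_der : forall u a b, anchor u (a * b) = anchor u a * b + a * anchor u b;
  anchor_linA : forall c u v a,
    anchor (c *: u + v) a = c * anchor u a + anchor v a;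
  anchor_bracket : forall u v a,
    anchor (bracket u v) a = anchor u (anchor v a) - anchor v (anchor u a);
  pairing_sym : forall u v, pairing u v = pairing v u;
  pairing_linA : forall c u v w,
    pairing (c *: u + v) w = c * pairing u w + pairing v w;
  cder_lin : forall (k : K) a b,
    cder (k *: a + b) = (k *: (1 : A)) *: cder a + cder b;
  cder_der : forall a b, cder (a * b) = a *: cder b + b *: cder a;
  anchor_cder : forall a b, anchor (cder a) b = 0;
  bracket_scale : forall u a v,
    bracket u (a *: v) = a *: bracket u v + anchor u a *: v;
  pairing_invariant : forall u v w,
    pairing (bracket u v) w + pairing v (bracket u w) = anchor u (pairing v w);
  bracket_cder : forall u a, bracket u (cder a) = cder (anchor u a);
  pairing_cder : forall u a, pairing u (cder a) = anchor u a;
  bracket_sym : forall u v, bracket u v + bracket v u = cder (pairing u v)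
}.

(* The function f : nat -> V stands for the series sum_n f n x^(-n-1). *)
Section Series.
Variables (K : fieldType) (V : lmodType K).
Implicit Types (D : V -> V) (f : nat -> V).

(* d/dx f(x) *)
Definition ser_deriv f : nat -> V := fun p => - (p%:R *: f p.-1).

(* f(-x) *)
Definition ser_opp f : nat -> V := fun p => (- 1) ^+ p.+1 *: f p.

(* Sing (e^(x D) f(x)), for f finitely supported *)
Definition sing_exp D f : nat -> V := fun p =>
  \sum_(i \in [set: nat]) (i`!%:R : K)^-1 *: iter i D (f (p + i)%N).
End Series.

(* AB = A (+) B; CAB = C(A (+) B); CB is the vertex Lie algebra C, the quotient
   of CAB; SC = S(C); SCB = S(C)_B. In each prodX n x y stands for x_n y, the
   coefficient of z^(-n-1) in Y_-(x, z) y, and DX for the operator D. *)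
Section Construction.
Variables (K : fieldType) (A : comPzAlg K) (B : courant A).

Definition AB : Type := (A * restr B)%type.
HB.instance Definition _ := GRing.Lmodule.on AB.

Definition inA (a : A) : AB := (a, 0).
Definition inB (b : B) : AB := (0, b).

(* u_p v, for u, v in A (+) B *)
Definition prodAB (p : nat) (u v : AB) : AB :=
  match p with
  | 0 => (anchor (u.2 : B) v.1 - anchor (v.2 : B) u.1,
          bracket (u.2 : B) (v.2 : B))
  | 1 => (pairing (u.2 : B) (v.2 : B), 0)
  | _ => 0
  end.

Definition CAB := dpoly AB.
HB.instance Definition _ := GRing.Lmodule.on CAB.

(* Y^0_-(u, x) (D^m v) for u, v in A (+) B: the coefficient of x_1^m / m! in
   e^(x_1 D) e^(- x_1 d/dx) is (D - d/dx)^m. *)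
Definition Y0AB (u : AB) (m : nat) (v : AB) : nat -> CAB :=
  iter m (fun f p => dshift (f p) - ser_deriv f p)
       (fun p => dmon 0 (prodAB p u v)).

(* Y^0_-(D^n (x) u, x) (D^m (x) v), which for n >= 1 is
   Sing (e^(x D) (- d/dx)^m (Y^0_-(v, -x) (D^n (x) u))). *)
Definition Y0mon (n : nat) (u : AB) (m : nat) (v : AB) : nat -> CAB :=
  if n is 0 then Y0AB u m v
  else sing_exp (@dshift K AB)
         (iter m (fun f p => - ser_deriv f p) (ser_opp (Y0AB v n u))).

(* f_p g, for f, g in C(A (+) B) *)
Definition prodCAB (p : nat) (f g : CAB) : CAB :=
  \sum_(n \in [set: nat]) \sum_(m \in [set: nat]) Y0mon n (f n) m (g m) p.

(* D^n (x) a |-> D^n (x) da - D^(n+1) (x) a *)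
Definition dhat (f : dpoly A) : CAB :=
  \sum_(n \in [set: nat])
     (dmon n (inB (cder B (f n))) - dmon n.+1 (inA (f n))).

(* range dhat is a subspace, hence equal to its span. *)
Definition CB := quotlmod (range dhat).
HB.instance Definition _ := GRing.Lmodule.on CB.
HB.instance Definition _ := EqQuotient.on CB.

(* range dhat is stable under D and an ideal for the products: the operations
   on CB do not depend on the representatives. *)
Definition DCB : CB -> CB := lift_op1 CB (@dshift K AB).
Definition prodCB (p : nat) : CB -> CB -> CB := lift_op2 CB (prodCAB p).

(* The class of D^n u *)
Definition classCB (n : nat) (u : AB) : CB := \pi_CB (dmon n u).

Definition CAB_grade (d : nat) : set CAB :=
  [set` lspan [set f | (exists a, f = dmon d (inA a)) \/
                      (exists n b, n.+1 = d /\ f = dmon n (inB b))]].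
Definition CB_grade (d : nat) : set CB := [set \pi_CB f | f in CAB_grade d].

Definition SC := symalg CB.
HB.instance Definition _ := GRing.ComAlgebra.on SC.
HB.instance Definition _ := EqQuotient.on SC.

Definition SC_grade (d : nat) : set SC :=
  [set` lspan [set x | exists s : seq (nat * CB),
    [/\ forall p, p \in s -> CB_grade p.1 p.2, (\sum_(p <- s) p.1)%N = d
      & x = \prod_(p <- s) sym_inj p.2]]].

Definition DSC : SC -> SC := der_ext (fun u => sym_inj (DCB u)).

(* The coefficient of x^(-n-1) in tilde Y^0_-(u, x) *)
Definition Yt (u : CB) (n : nat) : SC -> SC :=
  der_ext (fun v => sym_inj (prodCB n u v)).

(* The coefficient of x^(-n-1) in Y_-(a, x) *)
Definition prodSC (n : nat) (a : SC) : SC -> SC :=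
  der_ext (fun u => sing_exp DSC (ser_opp (fun k => Yt u k a)) n).

(* The images of a and b in S(C) *)
Definition SC_A (a : A) : SC := sym_inj (classCB 0 (inA a)).
Definition SC_B (b : B) : SC := sym_inj (classCB 0 (inB b)).

Definition relE0 : set SC :=
  [set` lspan [set x | x = SC_A 1 - 1 \/
                      exists a a', x = SC_A a * SC_A a' - SC_A (a * a')]].
Definition relE1 : set SC :=
  [set` lspan [set x | exists a (b : B), x = SC_A a * SC_B b - SC_B (a *: b)]].
Definition relE : set SC := [set x + y | x in relE0 & y in relE1].
(* The span of the D^m x, x in relE; its ideal DrelE.S(C) is I_B. *)
Definition DrelE : set SC :=
  [set` lspan [set y | exists m x, relE x /\ y = iter m DSC x]].

Definition SCB := quotalg DrelE.
HB.instance Definition _ := GRing.ComPzRing.on SCB.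
HB.instance Definition _ := GRing.Lmodule.on SCB.
HB.instance Definition _ := EqQuotient.on SCB.

(* I_B is an ideal of the vertex Poisson algebra S(C): the operations on the
   quotient do not depend on the representatives. *)
Definition DSCB : SCB -> SCB := lift_op1 SCB DSC.
Definition prodSCB (n : nat) : SCB -> SCB -> SCB := lift_op2 SCB (prodSC n).

Definition SCB_grade (d : nat) : set SCB := [set \pi_SCB x | x in SC_grade d].

Definition natA (a : A) : SCB := \pi_SCB (SC_A a).
Definition natB (b : B) : SCB := \pi_SCB (SC_B b).

Definition natA_alg_isom : Prop :=
  [/\ set_bij [set: A] (SCB_grade 0) natA,
      forall (k : K) a a', natA (k *: a + a') = k *: natA a + natA a',
      natA 1 = 1
    & forall a a', natA (a * a') = natA a * natA a'].

(* The Courant algebroid structure in degree 1 is [u, v] = u_0 v,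
   <u, v> = u_1 v, pi(u)(a) = u_0 a and the restriction of D; degree 0 is
   identified with A by natA. *)
Definition natB_courant_isom : Prop :=
  [/\ set_bij [set: B] (SCB_grade 1) natB,
      forall (k : K) (u v : B),
        natB ((k *: (1 : A)) *: u + v) = k *: natB u + natB v
    & forall a (u : B), natB (a *: u) = natA a * natB u] /\
  [/\ forall u v : B, natB (bracket u v) = prodSCB 0 (natB u) (natB v),
      forall u v : B, natA (pairing u v) = prodSCB 1 (natB u) (natB v),
      forall (u : B) a, natA (anchor u a) = prodSCB 0 (natB u) (natA a)
    & forall a, natB (cder B a) = DSCB (natA a)].
End Construction.

(* Main.v *)
(* Spanning: modulo [I_B], an element of [A] times a monomial in the [D^n b] can
   be rewritten without its [A]-factor through
   [a D^(n+1) b = D (a D^n b) - (D a) (D^n b)] and [D a = cder a], so the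
     classes
   of degree [n >= 1] are spanned by the monomials in the [D^n b] alone.
   Injectivity: sending [a], [b], [D a] to [a], [b], [cder a] and the rest of
     [C]
   to 0 defines an algebra map from [S(C)] to the square-zero extension [A + B];
   it intertwines [D] with [(a, b) |-> (0, cder a)], hence kills [I_B].
   Compatibility of the products: derivations of [S(C)] are determined by their
   values on [C], so [u_n] commutes with [D] up to [n u_(n-1)], and stability of
   [I_B] under all [u_n] reduces to [u] in [A + B] acting on the generators of
     [E],
   where it is the Courant algebroid axioms; the products [x_n] of arbitrary [x]
   follow by skew-symmetry. *)
Require Import Defs.
From HB Require Import structures.
From mathcomp Require Import all_boot all_order all_algebra.
From mathcomp Require Import finmap monalg ring.
From mathcomp Require Import boolp classical_sets functions fsbigop reals
  complex.

Set Implicit Arguments.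
Unset Strict Implicit.
Unset Printing Implicit Defensive.

Import GRing.Theory.
Local Open Scope classical_set_scope.
Local Open Scope ring_scope.
Local Open Scope quotient_scope.

(** * Linear maps and spans *)

(** Before the quotient by the range of [dhat], the products are not skew-symmetric: [u_0 v + v_0 u]
    is [cder] of the pairing where skew-symmetry asks for [D] of it, and the two agree only in [C].
    The two clauses of [Y0mon], for [n = 0] and [n >= 1], can therefore be reconciled only after
    projection. There both become [(D - d/dx)^m (d/dx)^n Y(u, x) v] for [Y(D^n u, x) D^m v], and
    translation rules, skew-symmetry and independence of representatives are read off from this
    closed form. Several operations are total with a default: quotient operations act on chosen
    representatives, [der_ext] is 0 when no extension exists, and a sum over [nat] is 0 when its
    support is infinite. Hence stability, linearity and finiteness have to be established before
    anything can be computed. The square-zero extension appears because only degrees 0 and 1 are to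
    be recognised: a product of two elements of [B] has degree 2 and may be sent to 0.
    Characteristic zero enters through the coefficients [1/i!] of [e^(x D)]. *)

Section Span.
Variables (K : fieldType) (V : lmodType K) (E : set V).

Lemma lspan_gen x : E x -> x \in lspan E.
Proof.
move=> Ex; apply/asboolP; exists [:: (1, x)]; last first.
  by rewrite big_seq1 scale1r.
by move=> p; rewrite inE => /eqP ->.
Qed.

Lemma lspan_ind (P : V -> Prop) :
  P 0 -> (forall k x y, E x -> P y -> P (k *: x + y)) ->
  forall x, x \in lspan E -> P x.
Proof.
move=> P0 PD x /asboolP[s sE ->]; elim: s sE => [|p s IHs] sE.
  by rewrite big_nil.
rewrite big_cons; apply: PD; first by apply: sE; rewrite inE eqxx.
by apply: IHs => q sq; apply: sE; rewrite inE sq orbT.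
Qed.
End Span.

Definition klinear (K : fieldType) (V W : lmodType K) (f : V -> W) :=
  forall k x y, f (k *: x + y) = k *: f x + f y.

Section KLinear.
Variables (K : fieldType) (V W : lmodType K) (f : V -> W).
Hypothesis f_lin : klinear f.

Lemma klin0 : f 0 = 0.
Proof. by have := f_lin (-1) 0 0; rewrite !scaleN1r oppr0 addr0 addNr. Qed.
Lemma klinD x y : f (x + y) = f x + f y.
Proof. by have := f_lin 1 x y; rewrite !scale1r. Qed.
Lemma klinZ k x : f (k *: x) = k *: f x.
Proof. by have := f_lin k x 0; rewrite klin0 !addr0. Qed.
Lemma klinB x y : f (x - y) = f x - f y.
Proof. by have := f_lin (-1) y x; rewrite !scaleN1r ![- _ + _]addrC. Qed.
Lemma klin_sum (I : Type) (r : seq I) (P : pred I) (F : I -> V) :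
  f (\sum_(i <- r | P i) F i) = \sum_(i <- r | P i) f (F i).
Proof. exact: (big_morph f klinD klin0). Qed.
End KLinear.

Lemma lspan_linear (K : fieldType) (V W : lmodType K) (E : set V) (F : set W)
    (f : V -> W) :
  klinear f -> (forall x, E x -> f x \in lspan F) ->
  forall x, x \in lspan E -> f x \in lspan F.
Proof.
move=> f_lin fE; apply: (lspan_ind (P := fun x => f x \in lspan F)).
  by rewrite klin0 // rpred0.
move=> k x y Ex Fy.
by rewrite f_lin; apply: rpredD Fy; apply: rpredZ; apply: fE.
Qed.

(** * Square-zero extensions *)

(** Used twice: with [M = R = S(V)] these are dual numbers, whose sections are the derivations of
    [S(V)]; with [R = A] and [M = B] it is the target that separates degrees 0 and 1. *)
Definition sqzero (R : comPzRingType) (M : lmodType R) : Type := (R * M)%type.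

Section SquareZero.
Variables (R : comPzRingType) (M : lmodType R).
Local Notation T := (sqzero M).

HB.instance Definition _ := GRing.Zmodule.on T.

Definition sqzero_one : T := (1, 0).
Definition sqzero_mul (x y : T) : T := (x.1 * y.1, x.1 *: y.2 + y.1 *: x.2).

Lemma sqzero_mulA : associative sqzero_mul.
Proof.
move=> x y z; apply: injective_projections => /=; first exact: mulrA.
by rewrite !scalerDr !scalerA addrA [z.1 * x.1]mulrC [z.1 * y.1]mulrC.
Qed.
Lemma sqzero_mulC : commutative sqzero_mul.
Proof. by move=> x y; rewrite /sqzero_mul mulrC addrC. Qed.
Lemma sqzero_mul1 : left_id sqzero_one sqzero_mul.
Proof.
by move=> [x m]; rewrite /sqzero_mul /= mul1r scale1r scaler0 addr0.
Qed.
Lemma sqzero_mulDl : left_distributive sqzero_mul +%R.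
Proof.
move=> x y z; apply: injective_projections => /=; first exact: mulrDl.
by rewrite scalerDl scalerDr addrACA.
Qed.

HB.instance Definition _ := GRing.Zmodule_isComPzRing.Build T
  sqzero_mulA sqzero_mulC sqzero_mul1 sqzero_mulDl.

Definition sqzero_inl (x : R) : T := (x, 0).
Lemma sqzero_inl_zmod : zmod_morphism sqzero_inl.
Proof. by move=> x y; apply: injective_projections; rewrite //= subr0. Qed.
Lemma sqzero_inl_monoid : monoid_morphism sqzero_inl.
Proof.
split=> // x y; apply: injective_projections => //=.
by rewrite !scaler0 addr0.
Qed.
HB.instance Definition _ :=
  GRing.isZmodMorphism.Build R T sqzero_inl sqzero_inl_zmod.
HB.instance Definition _ :=
  GRing.isMonoidMorphism.Build R T sqzero_inl sqzero_inl_monoid.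
End SquareZero.

Lemma sqzero_mul2 (R : comPzRingType) (x y : sqzero R^o) :
  (x * y).2 = x.2 * y.1 + x.1 * y.2.
Proof. by rewrite addrC [x.2 * _]mulrC. Qed.

(* The first factor makes the ring nontrivial, as [mmap] requires. *)
Definition augmented (K : fieldType) (T : comPzRingType) : Type := (K * T)%type.

Section Augmented.
Variables (K : fieldType) (T : comPzRingType).
Local Notation KT := (augmented K T).

HB.instance Definition _ := GRing.ComPzRing.on KT.
Lemma augmented_oner_neq0 : (1 : KT) != 0.
Proof. by apply/eqP => -[/eqP]; rewrite oner_eq0. Qed.
HB.instance Definition _ :=
  GRing.PzSemiRing_isNonZero.Build KT augmented_oner_neq0.
End Augmented.

(** * Universal property of the symmetric algebra *)

Lemma malg_monomialM (M : monomType) (R : nzRingType) (m n : M) :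
  << mmul m n >> = << m >> * << n >> :> {malg R[M]}.
Proof. by rewrite malgME !msuppU1 !big_seq_fset1 !mcoeffUU mulr1. Qed.

Section CommutativeMonomials.
Variable (V : choiceType).

Lemma cmonom_ind (P : {cmonom V} -> Prop) :
  P mone -> (forall v m, P m -> P (mmul (ucm v) m)) -> forall m, P m.
Proof.
move=> P1 PM m; have [n] := ubnP (mdeg m); elim: n m => // n IHn m.
have [->//|m1] := eqVneq m mone.
have [v mv] : exists v, m v != 0%N.
  apply/not_existsP => m0; case/eqP: m1; apply/eqP/cmP => v.
  by rewrite cm1; apply/eqP; apply: contrapT => /negP /m0.
have -> : m = mmul (ucm v) (divcm m (ucm v)).
  apply/eqP/cmP => w; rewrite cmM divcmE ucmE.
  by case: eqP => [<-|]; rewrite ?add0n ?subn0// subnKC // lt0n.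
by rewrite mdegM mdegU add1n ltnS => /IHn/PM.
Qed.

Section Evaluation.
Variables (S : comNzRingType) (g : V -> S).

Definition cmeval (m : {cmonom V}) : S := \prod_(v <- finsupp m) g v ^+ m v.

Lemma cmevalEw (d : {fset V}) (m : {cmonom V}) : (finsupp m `<=` d)%fset ->
  cmeval m = \prod_(v <- d) g v ^+ m v.
Proof.
move=> le; rewrite /cmeval (big_fset_incl _ le) //.
by move=> v _; rewrite -cmE_neq0 negbK => /eqP ->.
Qed.

Lemma cmeval_mmorphism : mmorphism cmeval.
Proof.
split=> [m1 m2|]; last by rewrite /cmeval mdom1 big_seq_fset0.
rewrite {1}/cmeval mdomD (cmevalEw (fsubsetUl _ (finsupp m2))).
rewrite (cmevalEw (fsubsetUr (finsupp m1) _)) -big_split /=.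
by apply: eq_bigr => v _; rewrite cmM exprD.
Qed.
HB.instance Definition _ :=
  isMultiplicative.Build {cmonom V} S cmeval cmeval_mmorphism.

Lemma cmevalU v : cmeval (ucm v) = g v.
Proof. by rewrite /cmeval mdomU big_seq_fset1 cmUU. Qed.
End Evaluation.
End CommutativeMonomials.

Section SymmetricAlgebra.
Variables (K : fieldType) (V : lmodType K).
Local Notation S := (symalg V).

Lemma pi_sym_mul (x y : {malg K[{cmonom V}]}) :
  \pi_S (x * y) = \pi_S x * \pi_S y :> S.
Proof. exact: pi_qmul. Qed.

Lemma pi_sym_lin k (x y : {malg K[{cmonom V}]}) :
  \pi_S (k *: x + y) = k *: \pi_S x + \pi_S y :> S.
Proof.
have Z : \pi_S (k *: x) = k *: \pi_S x := pi_qscale (ideal_gen (@symrel K V)) k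
  x.
by rewrite -Z; exact: (pi_quotD (ideal_gen (@symrel K V))).
Qed.

Lemma sym_inj_lin k (u v : V) :
  sym_inj (k *: u + v) = k *: sym_inj u + sym_inj v.
Proof.
rewrite -pi_sym_lin; apply/quot_eqP; apply: lspan_gen.
exists 1 => //; exists (symvar (k *: u + v) - (k *: symvar u + symvar v)).
  by exists k, u, v.
by rewrite mul1r.
Qed.

Lemma sym_ind (P : S -> Prop) :
  P 1 -> (forall v x, P x -> P (sym_inj v * x)) ->
  (forall k x y, P x -> P y -> P (k *: x + y)) -> forall x, P x.
Proof.
move=> P1 PM PD x; rewrite -[x]reprK; move: (repr x) => {}x.
have P0 : P 0 by have := PD (-1) _ _ P1 P1; rewrite scaleN1r addNr.
rewrite [x]monalgE; elim/big_rec: _ => [|m y _ Py].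
  by rewrite [\pi_S 0]pi_quot0.
have -> : << x@_m *g m >> = x@_m *: << m >> :> {malg K[{cmonom V}]}.
  by apply/malgP => m'; rewrite mcoeffU mcoeffZ mcoeffU mulr_natr.
rewrite (pi_sym_lin x@_m << m >> y).
apply: (PD _ _ _ _ Py); elim/cmonom_ind: m {Py} => [|v m Pm]; first exact: P1.
have -> : << mmul (ucm v) m >> = symvar v * << m >> :> {malg K[{cmonom V}]}.
  exact: malg_monomialM.
by rewrite (pi_sym_mul (symvar v) << m >>); apply: PM.
Qed.

(** Scalars act through [i], since the targets are only built as rings. The polynomial ring is
    evaluated in [K * T], nontrivial even for [T = 0], and the second component is kept. *)
Lemma sym_lift (T : comPzRingType) (i : {rmorphism K -> T}) (g : V -> T) :
  (forall k u v, g (k *: u + v) = i k * g u + g v) ->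
  exists f : S -> T, [/\ f 1 = 1, forall x y, f (x * y) = f x * f y,
    forall k x y, f (k *: x + y) = i k * f x + f y
    & forall v, f (sym_inj v) = g v].
Proof.
move=> g_lin.
pose KT : comNzRingType := augmented K T.
pose i' (k : K) : KT := (k, i k).
have i'_add : zmod_morphism i'.
  by move=> k l; apply: injective_projections; rewrite //= raddfB.
have i'_mul : monoid_morphism i'.
  by split=> [|k l]; apply: injective_projections;
    rewrite //= ?rmorph1 ?rmorphM.
pose I' : {rmorphism K -> KT} :=
  HB.pack i' (GRing.isZmodMorphism.Build _ _ i' i'_add)
    (GRing.isMonoidMorphism.Build _ _ i' i'_mul).
pose g' (v : V) : KT := (0, g v).
pose h : {mmorphism {cmonom V} -> KT} := cmeval g'.
pose F := mmap I' h.
have FE v : F (symvar v) = g' v.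
  by rewrite /F mmapU [X in X * _](rmorph1 I') mul1r; exact: cmevalU.
have F1 : F 1 = 1 by exact: mmap1.
have FM x y : F (x * y) = F x * F y by exact: (mmap_is_multiplicative (f := I')
  (h := h)).1.
have FD k x y : F (k *: x + y) = I' k * F x + F y.
  by rewrite -(mmapZ k x : F _ = _); exact: mmapD.
have FB x y : F (x - y) = F x - F y by exact: mmapB.
have F0 : F 0 = 0 by exact: mmap0.
clearbody F.
have FI x : x \in lspan (ideal_gen (@symrel K V)) -> (F x).2 = 0.
  move: x; apply: (lspan_ind (P := fun x => (F x).2 = 0)).
    by rewrite F0.
  move=> k _ y [x _ [_ [l [u [v ->]] <-]]] Fy; rewrite FD /= Fy addr0.
  move: (FE (l *: u + v)) (FE u) (FE v).
  move: (symvar (l *: u + v)) (symvar u) (symvar v) => X Y Z FX FY FZ.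
  rewrite FM FB FD FX FY FZ.
  change (i k * ((F x).2 * (g (l *: u + v) - (i l * g u + g v))) = 0).
  by rewrite g_lin subrr !mulr0.
have Fpi x : (F (repr (\pi_S x))).2 = (F x).2.
  apply/eqP; rewrite -subr_eq0; apply/eqP.
  change ((F (repr (\pi_S x)) - F x).2 = 0).
  by rewrite -FB; apply: FI; apply: quot_reprP.
exists (fun x => (F (repr x)).2); split.
- by rewrite [1](_ : _ = \pi_S 1)// Fpi F1.
- by move=> x y; rewrite -{1}[x]reprK -{1}[y]reprK -pi_sym_mul Fpi FM.
- by move=> k x y; rewrite -{1}[x]reprK -{1}[y]reprK -pi_sym_lin Fpi FD.
- by move=> v; rewrite Fpi FE.
Qed.
End SymmetricAlgebra.

(** * Derivations *)

Section Derivations.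
Variables (K : fieldType) (S : comAlgType K).
Implicit Types d : S -> S.

Definition derivation d :=
  klinear d /\ forall x y, d (x * y) = d x * y + x * d y.

Lemma der1 d : derivation d -> d 1 = 0.
Proof.
move=> [_ dM]; have := dM 1 1; rewrite !mulr1 mul1r.
by move/(congr1 (fun x => x - d 1)); rewrite subrr addrK.
Qed.

Lemma der_comb k d d' : derivation d -> derivation d' ->
  derivation (fun x => k *: d x + d' x).
Proof.
move=> [dL dM] [d'L d'M]; split=> [l x y|x y].
  by rewrite dL d'L !scalerDr !scalerA [l * k]mulrC addrACA.
by rewrite dM d'M mulrDl mulrDr scalerDr -scalerAl -scalerAr addrACA.
Qed.

Lemma der_comm d d' : derivation d -> derivation d' ->
  derivation (fun x => d (d' x) - d' (d x)).
Proof.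
move=> [dL dM] [d'L d'M]; split=> [l x y|x y].
  by rewrite d'L !dL d'L scalerBr opprD addrACA.
by rewrite dM d'M (klinD dL) (klinD d'L) !dM !d'M; ring.
Qed.
End Derivations.

Section DerivationExtension.
Variables (K : fieldType) (V : lmodType K).
Local Notation S := (symalg V).

(** A derivation [d] amounts to an algebra map [x |-> x + (d x) eps] into the dual numbers. The
    universal property extends [v |-> v + (f v) eps]; the first component stays the identity because
    it is so on generators. *)
Lemma der_ext_exists (f : V -> S) : klinear f ->
  exists d, is_derivation d /\ forall v, d (sym_inj v) = f v.
Proof.
move=> f_lin; pose i := @sqzero_inl S S^o \o in_alg S.
have [|F [F1 FM FD Fg]] := @sym_lift K V (sqzero S^o) i (fun v => (sym_inj v, f
  v)).
  move=> k u v; apply: injective_projections.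
    by rewrite /= -scalerAl mul1r -sym_inj_lin.
  by rewrite /= scaler0 addr0 f_lin; congr (_ + _); rewrite [RHS]mulr_algl.
have F_fst x : (F x).1 = x.
  elim/sym_ind: x => [|v x IHx|k x y IHx IHy]; first by rewrite F1.
    by rewrite FM Fg /= IHx.
  by rewrite FD /= IHx IHy -scalerAl mul1r.
exists (fun x => (F x).2); split; last by move=> v; rewrite Fg.
split=> [k x y|x y].
  by rewrite FD /= scaler0 addr0; congr (_ + _); rewrite [LHS]mulr_algl.
by rewrite FM sqzero_mul2 !F_fst.
Qed.

(** Linearity of [f] guarantees an extension, so that [xget] does not return its default. *)
Lemma der_ext_der (f : V -> S) : klinear f -> derivation (der_ext f).
Proof. by move=> /der_ext_exists/xgetPex => /(_ (fun=> 0))[]. Qed.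

Lemma der_extE (f : V -> S) v : klinear f -> der_ext f (sym_inj v) = f v.
Proof. by move=> /der_ext_exists/xgetPex => /(_ (fun=> 0))[_ /(_ v)]. Qed.
End DerivationExtension.

(** * Series and skew-symmetry *)

(** A sum over all of [nat] has the value 0 when infinitely many terms are nonzero, so an explicit
    bound on the support is what makes it computable. *)
Lemma fsum_nat (V : nmodType) N (F : nat -> V) :
  (forall n, (N <= n)%N -> F n = 0) ->
  \sum_(n \in [set: nat]) F n = \sum_(n < N) F n.
Proof.
move=> F0; rewrite fsbig_ord; apply/esym/fsbig_widen => //.
by move=> n [_ /= /negP]; rewrite -leqNgt => /F0.
Qed.

Lemma fin_suppP (K : fieldType) (V : lmodType K) (f : nat -> V) :
  reflect (exists N, forall n, (N <= n)%N -> f n = 0) (f \in @fin_supp K V).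
Proof. exact: asboolP. Qed.

(* - d/dx f(x), where f n stands for the coefficient of x^(-n-1) *)
Definition sder (K : fieldType) (V : lmodType K) (f : nat -> V) : nat -> V :=
  fun p => p%:R *: f p.-1.
Arguments sder {K V}.

Section Series.
Variables (K : fieldType) (V : lmodType K).
Implicit Types f g : nat -> V.

Lemma serN_deriv f p : - ser_deriv f p = sder f p.
Proof. by rewrite /ser_deriv opprK. Qed.

Lemma fin_supp_sder f : f \in @fin_supp K V -> sder f \in @fin_supp K V.
Proof.
move=> /fin_suppP[N fN]; apply/fin_suppP; exists N.+1 => -[//|n] Nn.
by rewrite /sder fN ?scaler0.
Qed.

Lemma fin_supp_opp f : f \in @fin_supp K V -> ser_opp f \in @fin_supp K V.
Proof.
move=> /fin_suppP[N fN]; apply/fin_suppP; exists N => n Nn.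
by rewrite /ser_opp fN ?scaler0.
Qed.

Lemma fin_supp_comb k f g : f \in @fin_supp K V -> g \in @fin_supp K V ->
  (fun p => k *: f p + g p) \in @fin_supp K V.
Proof.
move=> /fin_suppP[M fM] /fin_suppP[N gN]; apply/fin_suppP; exists (maxn M N).
by move=> n; rewrite geq_max => /andP[Mn Nn]; rewrite fM ?gN ?scaler0 ?addr0.
Qed.

Lemma fin_supp_map (W : lmodType K) (h : V -> W) f :
  klinear h -> f \in @fin_supp K V -> (fun p => h (f p)) \in @fin_supp K W.
Proof.
move=> h_lin /fin_suppP[N fN]; apply/fin_suppP; exists N => n Nn.
by rewrite fN ?klin0.
Qed.

Lemma sder_lin k f g :
  sder (fun p => k *: f p + g p) = fun p => k *: sder f p + sder g p.
Proof.
by apply/funext => p; rewrite /sder scalerDr !scalerA mulrC.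
Qed.

Lemma sder_map (W : lmodType K) (h : V -> W) f : klinear h ->
  sder (fun p => h (f p)) = fun p => h (sder f p).
Proof. by move=> h_lin; apply/funext => p; rewrite /sder klinZ. Qed.

Lemma ser_opp_lin k f g :
  ser_opp (fun p => k *: f p + g p) = fun p => k *: ser_opp f p + ser_opp g p.
Proof.
by apply/funext => p; rewrite /ser_opp scalerDr !scalerA mulrC.
Qed.

Lemma ser_opp_map (W : lmodType K) (h : V -> W) f : klinear h ->
  ser_opp (fun p => h (f p)) = fun p => h (ser_opp f p).
Proof. by move=> h_lin; apply/funext => p; rewrite /ser_opp klinZ. Qed.

Lemma ser_opp_sder f : ser_opp (sder f) = fun p => - sder (ser_opp f) p.
Proof.
apply/funext => -[|p]; rewrite /ser_opp /sder;
  first by rewrite !scale0r scaler0 oppr0.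
by rewrite !scalerA exprS mulN1r mulNr scaleNr mulrC.
Qed.

Section SingExp.
Variables (D : V -> V).
Hypothesis D_lin : klinear D.
Hypothesis pcharK : [pchar K] =i pred0.

Lemma iter_klin n : klinear (iter n D).
Proof. by elim: n => [|n IHn] k x y //=; rewrite IHn D_lin. Qed.

Lemma sing_expE N f p : (forall n, (N <= n)%N -> f n = 0) ->
  sing_exp D f p = \sum_(i < N) (i`!%:R : K)^-1 *: iter i D (f (p + i)%N).
Proof.
move=> fN; apply: fsum_nat => n Nn.
by rewrite fN ?(klin0 (iter_klin _)) ?scaler0// (leq_trans Nn)// leq_addl.
Qed.

Lemma sing_exp_lin k f g p : f \in @fin_supp K V -> g \in @fin_supp K V ->
  sing_exp D (fun p => k *: f p + g p) p = k *: sing_exp D f p + sing_exp D g p.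
Proof.
move=> /fin_suppP[M fM] /fin_suppP[N gN].
have fMN n : (maxn M N <= n)%N -> f n = 0.
  by rewrite geq_max => /andP[? _]; apply: fM.
have gMN n : (maxn M N <= n)%N -> g n = 0.
  by rewrite geq_max => /andP[_ ?]; apply: gN.
have fgMN n : (maxn M N <= n)%N -> k *: f n + g n = 0.
  by move=> Nn; rewrite fMN ?gMN ?scaler0 ?addr0.
rewrite (sing_expE _ fMN) (sing_expE _ gMN) (sing_expE _ fgMN).
rewrite scaler_sumr -big_split /=; apply: eq_bigr => i _.
by rewrite iter_klin scalerDr !scalerA mulrC.
Qed.

Lemma sing_exp_map (W : lmodType K) (D' : W -> W) (h : V -> W) f p :
  klinear D' -> klinear h -> (forall x, h (D x) = D' (h x)) ->
  f \in @fin_supp K V ->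
  h (sing_exp D f p) = sing_exp D' (fun p => h (f p)) p.
Proof.
move=> D'_lin h_lin hD /fin_suppP[N fN]; rewrite (sing_expE _ fN).
rewrite (klin_sum h_lin) [RHS](@fsum_nat _ N).
  apply: eq_bigr => i _; rewrite (klinZ h_lin); congr (_ *: _).
  by elim: (nat_of_ord i) (f _) => //= n IHn x; rewrite hD IHn.
move=> n Nn; rewrite fN ?(leq_trans Nn) ?leq_addl// (klin0 h_lin).
have -> : iter n D' 0 = 0 by elim: n {Nn} => //= n ->; rewrite klin0.
by rewrite scaler0.
Qed.

Lemma sing_exp_D f p : f \in @fin_supp K V ->
  sing_exp D (fun p => D (f p)) p = D (sing_exp D f p).
Proof. by move=> ff; rewrite -(sing_exp_map _ D_lin D_lin). Qed.

(** This is [e^(x D) (- d/dx) = (D - d/dx) e^(x D)], read on coefficients. *)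
Lemma sing_exp_sder f p : f \in @fin_supp K V ->
  sing_exp D (sder f) p = D (sing_exp D f p) + sder (sing_exp D f) p.
Proof.
move=> /fin_suppP[N fN].
have dfN n : (N.+1 <= n)%N -> sder f n = 0.
  by case: n => // n Nn; rewrite /sder fN ?scaler0.
have fSN n : (N.+1 <= n)%N -> f n = 0 by move=> /ltnW/fN.
rewrite (sing_expE _ dfN) (sing_expE _ fN) /sder (sing_expE _ fSN).
have iS i : (i.+1`!%:R : K)^-1 * i.+1%:R = (i`!%:R)^-1.
  have n0 n : (n.+1%:R : K) != 0 by rewrite ((pcharf0P K).1 pcharK).
  by rewrite factS natrM invfM mulrC mulrA divff ?mul1r.
(* The factor [p + i] of the [i]-th term splits: [p] gives the derivative of the exponential, and
   [i / i! = 1 / (i - 1)!] gives [D] after a shift of the index. Truncated predecessors at 0 carry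
   the coefficient 0. *)
rewrite (eq_bigr (fun i : 'I_N.+1 =>
    (i`!%:R : K)^-1 *: (i%:R *: iter i D (f (p + i).-1)) +
    p%:R *: ((i`!%:R : K)^-1 *: iter i D (f (p.-1 + i)%N)))); last first.
  move=> i _; rewrite (klinZ (iter_klin _)) natrD scalerDl scalerDr addrC.
  congr (_ + _); rewrite !scalerA mulrC.
  by case: p => [|p]; rewrite ?mul0r ?scale0r.
rewrite big_split /= -scaler_sumr; congr (_ + _).
rewrite big_ord_recl /= scale0r scaler0 add0r (klin_sum D_lin).
apply: eq_bigr => i _; rewrite (klinZ D_lin) /= scalerA.
by rewrite /bump /= add1n iS addnS.
Qed.

(* (D - d/dx) f(x) and d/dx f(x) *)
Definition sD f : nat -> V := fun p => D (f p) + sder f p.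
Definition nsder f : nat -> V := fun p => - sder f p.

Lemma sD_nsder f : sD (nsder f) = nsder (sD f).
Proof.
have D_N x : D (- x) = - D x by rewrite -scaleN1r (klinZ D_lin) scaleN1r.
apply/funext => p; rewrite /sD /nsder /sder D_N (klinZ D_lin) scalerN -opprD.
by rewrite -scalerDr.
Qed.

Lemma iter_sD_nsder n f : iter n sD (nsder f) = nsder (iter n sD f).
Proof. by elim: n => //= n ->; rewrite sD_nsder. Qed.

Lemma sD_iter_nsder n f : iter n nsder (sD f) = sD (iter n nsder f).
Proof. by elim: n => //= n ->; rewrite sD_nsder. Qed.

Lemma iter_sD_iter_nsder m n f :
  iter m sD (iter n nsder f) = iter n nsder (iter m sD f).
Proof. by elim: n => //= n IHn; rewrite iter_sD_nsder IHn. Qed.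

Lemma nsderE f : nsder f = fun p => - 1 *: sder f p + (fun=> 0) p.
Proof. by apply/funext => p; rewrite addr0 scaleN1r. Qed.

Lemma fin_supp_nsder f : f \in @fin_supp K V -> nsder f \in @fin_supp K V.
Proof.
move=> ff; rewrite nsderE.
by apply: fin_supp_comb; [exact: fin_supp_sder|apply/fin_suppP; exists 0].
Qed.

Lemma fin_supp_sD f : f \in @fin_supp K V -> sD f \in @fin_supp K V.
Proof.
move=> ff; have -> : sD f = fun p => 1 *: D (f p) + sder f p.
  by apply/funext => p; rewrite scale1r.
by apply: fin_supp_comb; [exact: fin_supp_map|exact: fin_supp_sder].
Qed.

Lemma fin_supp_iter (T : (nat -> V) -> (nat -> V)) n f :
  (forall g, g \in @fin_supp K V -> T g \in @fin_supp K V) ->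
  f \in @fin_supp K V -> iter n T f \in @fin_supp K V.
Proof. by move=> T_fin ff; elim: n => //= n; apply: T_fin. Qed.

(* The series of b_n a in terms of that of a_n b *)
Definition skew f := sing_exp D (ser_opp f).

Lemma ser_opp_nsder f : ser_opp (nsder f) = sder (ser_opp f).
Proof.
rewrite nsderE ser_opp_lin ser_opp_sder; apply/funext => p.
by rewrite scaleN1r opprK /ser_opp scaler0 addr0.
Qed.

Lemma skew_nsder f : f \in @fin_supp K V -> skew (nsder f) = sD (skew f).
Proof.
move=> ff; rewrite /skew ser_opp_nsder.
by apply/funext => p; rewrite sing_exp_sder ?fin_supp_opp.
Qed.

Lemma skew_sD f : f \in @fin_supp K V -> skew (sD f) = nsder (skew f).
Proof.
move=> ff; have off := fin_supp_opp ff.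
have -> : sD f = fun p => 1 *: D (f p) + sder f p.
  by apply/funext => p; rewrite scale1r.
rewrite /skew ser_opp_lin ser_opp_sder (ser_opp_map _ D_lin).
have -> : (fun p => 1 *: D (ser_opp f p) + - sder (ser_opp f) p) =
    (fun p => - 1 *: sder (ser_opp f) p + D (ser_opp f p)).
  by apply/funext => p; rewrite scale1r scaleN1r addrC.
apply/funext => p; rewrite sing_exp_lin ?fin_supp_sder//;
  last exact: fin_supp_map.
by rewrite scaleN1r sing_exp_sder // sing_exp_D // opprD addrAC addNr add0r.
Qed.

(** [D] on the left argument of a product is [d/dx], on the right argument [D - d/dx]. Skew-symmetry
    swaps the arguments, hence these two commuting operators together with their exponents. *)
Lemma skew_iter m n f : f \in @fin_supp K V ->
  skew (iter m sD (iter n nsder f)) = iter n sD (iter m nsder (skew f)).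
Proof.
move=> ff; rewrite iter_sD_iter_nsder.
have mfin : iter m sD f \in @fin_supp K V.
  by apply: fin_supp_iter ff; exact: fin_supp_sD.
elim: n => [|n IHn] /=; last first.
  by rewrite skew_nsder ?IHn// fin_supp_iter //; exact: fin_supp_nsder.
elim: m {mfin} => //= m IHm.
by rewrite skew_sD ?IHm// fin_supp_iter //; exact: fin_supp_sD.
Qed.

Lemma iter_sder_opp n f : iter n sder (ser_opp f) = ser_opp (iter n nsder f).
Proof. by elim: n => //= n ->; rewrite ser_opp_nsder. Qed.

Definition ser_linear (T : (nat -> V) -> (nat -> V)) :=
  (forall f, f \in @fin_supp K V -> T f \in @fin_supp K V) /\
  forall k f g, f \in @fin_supp K V -> g \in @fin_supp K V ->
    T (fun p => k *: f p + g p) = (fun p => k *: T f p + T g p).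

Lemma ser_linear_iter n T : ser_linear T -> ser_linear (iter n T).
Proof.
move=> [T_fin T_lin]; split=> [f ff|k f g ff fg]; first exact: fin_supp_iter.
by elim: n => //= n ->; rewrite T_lin ?fin_supp_iter.
Qed.

Lemma sD_linear : ser_linear sD.
Proof.
split=> [f|k f g _ _]; first exact: fin_supp_sD.
by apply/funext => p; rewrite /sD sder_lin D_lin scalerDr addrACA.
Qed.

Lemma nsder_linear : ser_linear nsder.
Proof.
split=> [f|k f g _ _]; first exact: fin_supp_nsder.
by apply/funext => p; rewrite /nsder sder_lin opprD scalerN.
Qed.

Lemma skew_lin k f g : f \in @fin_supp K V -> g \in @fin_supp K V ->
  skew (fun p => k *: f p + g p) = (fun p => k *: skew f p + skew g p).
Proof.
move=> ff fg; rewrite /skew ser_opp_lin; apply/funext => p.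
by rewrite sing_exp_lin ?fin_supp_opp.
Qed.
End SingExp.
End Series.
Arguments nsder {K V}.
Arguments sD {K V}.
Arguments skew {K V}.

Section SeriesMap.
Variables (K : fieldType) (V W : lmodType K) (D : V -> V) (D' : W -> W).
Variable h : V -> W.
Hypotheses (D_lin : klinear D) (D'_lin : klinear D') (h_lin : klinear h).
Hypothesis hD : forall x, h (D x) = D' (h x).
Implicit Types f : nat -> V.

Lemma iter_sD_map n f :
  (fun p => h (iter n (sD D) f p)) = iter n (sD D') (fun p => h (f p)).
Proof.
elim: n => //= n <-; apply/funext => p.
by rewrite /sD (sder_map _ h_lin) (klinD h_lin) hD.
Qed.

Lemma iter_nsder_map n f :
  (fun p => h (iter n nsder f p)) = iter n nsder (fun p => h (f p)).
Proof.
elim: n => //= n <-; apply/funext => p.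
by rewrite /nsder (sder_map _ h_lin) -sub0r (klinB h_lin) (klin0 h_lin) sub0r.
Qed.

Lemma skew_map f : f \in @fin_supp K V ->
  (fun p => h (skew D f p)) = skew D' (fun p => h (f p)).
Proof.
move=> ff; apply/funext => p; rewrite /skew (ser_opp_map _ h_lin).
exact: (sing_exp_map D_lin p D'_lin h_lin hD (fin_supp_opp ff)).
Qed.
End SeriesMap.

(** * The vertex Poisson ideal *)

Section VertexPoisson.
Variables (K : fieldType) (C : lmodType K) (S : comAlgType K) (inj : C -> S).
Hypothesis pcharK : [pchar K] =i pred0.
Hypothesis inj_lin : klinear inj.
Hypothesis S_ind : forall P : S -> Prop,
  P 1 -> (forall v x, P x -> P (inj v * x)) ->
  (forall k x y, P x -> P y -> P (k *: x + y)) -> forall x, P x.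

(** [S_ind] says that [inj] generates [S]. An identity in [S] thus reduces to one in [C] as soon as
    both sides are derivations in [x], which [der_comb] and [der_comm] provide. *)
Lemma der_eq d d' : derivation d -> derivation d' ->
  (forall v, d (inj v) = d' (inj v)) -> d =1 d'.
Proof.
move=> dd dd' ddE; elim/S_ind => [|v x IHx|k x y IHx IHy].
- by rewrite !der1.
- by rewrite dd.2 dd'.2 IHx ddE.
- by rewrite dd.1 dd'.1 IHx IHy.
Qed.

Variables (D : C -> C) (Y : nat -> C -> C -> C).
Hypothesis D_lin : klinear D.
Hypothesis Y_linl : forall n v, klinear (Y n ^~ v).
Hypothesis Y_Dl : forall n u v, Y n (D u) v = - sder (fun p => Y p u v) n.
Hypothesis Y_Dr : forall n u v,
  Y n u (D v) = D (Y n u v) + sder (fun p => Y p u v) n.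
Hypothesis Y_fin : forall u v, (fun n => Y n u v) \in @fin_supp K C.
Hypothesis Y_skew : forall n u v,
  Y n u v = sing_exp D (ser_opp (fun p => Y p v u)) n.

Variables (DS : S -> S) (Z : C -> nat -> S -> S).
Hypothesis DS_der : derivation DS.
Hypothesis DSE : forall u, DS (inj u) = inj (D u).
Hypothesis Z_der : forall u n, derivation (Z u n).
Hypothesis ZE : forall u n v, Z u n (inj v) = inj (Y n u v).

Lemma mode_linl n x : klinear (fun u => Z u n x).
Proof.
move=> k u v; move: x; apply: der_eq; [exact: Z_der|by apply: der_comb|] => w.
by rewrite !ZE Y_linl inj_lin.
Qed.

(** The Leibniz rule carries finiteness from [C] to products. The sums [sing_exp] over these series
    are then finite. *)
Lemma mode_fin u x : (fun n => Z u n x) \in @fin_supp K S.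
Proof.
elim/S_ind: x => [|v x|k x y].
- by apply/fin_suppP; exists 0 => n _; rewrite der1.
- have /fin_suppP[M uvM] := Y_fin u v; move=> /fin_suppP[N uxN].
  apply/fin_suppP; exists (maxn M N) => n.
  rewrite geq_max => /andP[/uvM uv0 /uxN ux0].
  by rewrite (Z_der u n).2 ZE uv0 ux0 (klin0 inj_lin) mul0r mulr0 addr0.
- move=> ux uy; have -> : (fun n => Z u n (k *: x + y)) =
      (fun n => k *: Z u n x + Z u n y).
    by apply/funext => n; rewrite (Z_der u n).1.
  exact: fin_supp_comb.
Qed.

Lemma mode_Dl u n x : Z (D u) n x = - sder (fun p => Z u p x) n.
Proof.
have -> : - sder (fun p => Z u p x) n = (- n%:R) *: Z u n.-1 x + 0.
  by rewrite addr0 scaleNr.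
move: x; apply: der_eq; first exact: Z_der.
  by apply: der_comb => //; split=> [k x y|x y];
    rewrite ?scaler0 ?mul0r ?mulr0 addr0.
by move=> v; rewrite !ZE Y_Dl /sder -scaleNr (klinZ inj_lin) addr0.
Qed.

Lemma mode_Dr u n x : Z u n (DS x) = DS (Z u n x) + sder (fun p => Z u p x) n.
Proof.
(* [Z u n] composed with [DS] is in general not a derivation; in the form [[Z u n, DS] = n Z u (n -
   1)] both sides are. *)
apply/eqP; rewrite addrC -subr_eq; apply/eqP.
have -> : sder (fun p => Z u p x) n = n%:R *: Z u n.-1 x + 0 by rewrite addr0.
move: x; apply: der_eq; first exact: der_comm.
  by apply: der_comb => //; split=> [k x y|x y];
    rewrite ?scaler0 ?mul0r ?mulr0 addr0.
move=> v; rewrite DSE !ZE DSE Y_Dr /sder (klinD inj_lin) addrAC subrr add0r.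
by rewrite (klinZ inj_lin) addr0.
Qed.

Definition skew_prod n (a : S) (u : C) : S :=
  sing_exp DS (ser_opp (fun k => Z u k a)) n.

(** The condition under which [der_ext] really extends [skew_prod n a] to a derivation of [S(C)]. *)
Lemma skew_prod_linr n a : klinear (skew_prod n a).
Proof.
move=> k u v; rewrite /skew_prod.
have -> : (fun p => Z (k *: u + v) p a) = (fun p => k *: Z u p a + Z v p a).
  by apply/funext => p; rewrite mode_linl.
rewrite ser_opp_lin (sing_exp_lin DS_der.1) ?fin_supp_opp ?mode_fin //.
Qed.

Lemma skew_prod_linl n u : klinear (skew_prod n ^~ u).
Proof.
move=> k a b; rewrite /skew_prod.
have -> : (fun p => Z u p (k *: a + b)) = (fun p => k *: Z u p a + Z u p b).
  by apply/funext => p; rewrite (Z_der u p).1.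
rewrite ser_opp_lin (sing_exp_lin DS_der.1) ?fin_supp_opp ?mode_fin //.
Qed.

Lemma skew_prod_inj n u v : skew_prod n (inj u) v = inj (Y n u v).
Proof.
rewrite Y_skew (sing_exp_map D_lin _ DS_der.1 inj_lin) ?fin_supp_opp//.
rewrite /skew_prod -(ser_opp_map _ inj_lin).
have -> // : (fun p => Z v p (inj u)) = (fun p => inj (Y p v u)).
by apply/funext => p; rewrite ZE.
Qed.

Variable P : nat -> S -> S -> S.
Hypothesis P_der : forall n a, derivation (P n a).
Hypothesis PE : forall n a u, P n a (inj u) = skew_prod n a u.

Lemma prod_linl n x : klinear (P n ^~ x).
Proof.
move=> k a b; move: x; apply: der_eq; [exact: P_der|by apply: der_comb|] => w.
by rewrite !PE skew_prod_linl.
Qed.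

(** Both are derivations, and on [C] their agreement is the skew-symmetry [Y_skew]. *)
Lemma prod_inj n u : P n (inj u) =1 Z u n.
Proof. by apply: der_eq => // v; rewrite PE skew_prod_inj ZE. Qed.

Variables (G : set C) (E : set S).
Hypothesis C_gen : forall u,
  u \in lspan [set v | exists n g, G g /\ v = iter n D g].
Let DE : set S := [set` lspan [set y | exists m x, E x /\ y = iter m DS x]].
Let I := lspan (ideal_gen DE).
Hypothesis Z_E : forall g n x, G g -> E x -> Z g n x \in I.

Let I_mul x y : y \in DE -> x * y \in I.
Proof. by rewrite inE => DEy; apply: lspan_gen; exists x => //; exists y. Qed.

Lemma dideal_D x : x \in I -> DS x \in I.
Proof.
apply: lspan_linear DS_der.1 _ _ => {}x [z _ [y DEy <-]].
have {}DEy : y \in DE by rewrite inE.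
rewrite DS_der.2; apply: rpredD; apply: I_mul => //.
move: DEy; rewrite !inE;
  apply: lspan_linear DS_der.1 _ _ => {}y [m [e [Ee ->]]].
by apply: lspan_gen; exists m.+1, e.
Qed.

(** Both translation rules involve the mode of index one lower, so the inductions on the number of
    [D]'s, first in [u] and then in [x], run over all modes at once. *)
Lemma dideal_mode u n x : x \in I -> Z u n x \in I.
Proof.
have ZuE e m : E e -> Z u m e \in I.
  move=> Ee; have := C_gen u; move: u.
  apply: (lspan_ind (P := fun u => Z u m e \in I)).
    by rewrite (klin0 (mode_linl m e)) rpred0.
  move=> k _ v [l [g [Gg ->]]] Iv; rewrite mode_linl rpredD ?rpredZ//.
  elim: l m {Iv} => [|l IHl] m /=; first exact: Z_E.
  by rewrite mode_Dl rpredN rpredZ.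
have ZuDE e m l : E e -> Z u m (iter l DS e) \in I.
  move=> Ee; elim: l m => [|l IHl] m /=; first exact: ZuE.
  by rewrite mode_Dr rpredD ?rpredZ ?dideal_D.
apply: lspan_linear (Z_der u n).1 _ _ => {}x [z _ [y DEy <-]].
have {}DEy : y \in DE by rewrite inE.
rewrite (Z_der u n).2; apply: rpredD; first exact: I_mul.
apply: ideal_absorb.
move: DEy; rewrite inE;
  apply: lspan_linear (Z_der u n).1 _ _ => {}y [m [e [Ee ->]]].
exact: ZuDE.
Qed.

(** As [P n a] is a derivation, values on [C] suffice. There it is a combination of the
    [DS^i (Z v k a)], so stability in the right argument yields stability in the left one. *)
Lemma dideal_prod n a x : a \in I -> P n a x \in I.
Proof.
move=> Ia; elim/S_ind: x => [|v x Ix|k x y Ix Iy].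
- by rewrite (der1 (P_der n a)) rpred0.
- rewrite (P_der n a).2; apply: rpredD; last exact: ideal_absorb.
  rewrite mulrC; apply: ideal_absorb; rewrite PE /skew_prod.
  have /fin_suppP[N aN] := fin_supp_opp (mode_fin v a).
  rewrite (sing_expE DS_der.1 _ aN) rpred_sum// => i _; apply: rpredZ.
  have : ser_opp (fun k => Z v k a) (n + i)%N \in I by rewrite rpredZ
    ?dideal_mode.
  elim: (nat_of_ord i) (ser_opp _ _) => //= m IHm y Iy.
  exact/dideal_D/IHm.
- by rewrite (P_der n a).1 rpredD ?rpredZ.
Qed.

End VertexPoisson.

Lemma cpa_scale1 (K : fieldType) (A : comPzAlg K) (k : K) (a : A) :
  (k *: (1 : A)) * a = k *: a.
Proof. by rewrite -[LHS]cpa_scaleAl [cpa_mul _ _]mul1r. Qed.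

(** * The products on C(A + B) *)

Section DPolynomials.
Variables (K : fieldType) (V : lmodType K).
Implicit Types f g : dpoly V.

Lemma dpolyP f g : (forall n, f n = g n) -> f = g.
Proof. by move=> fg; apply/val_inj/funext. Qed.

Lemma dcoef_lin n : klinear (fun f : dpoly V => f n).
Proof. by []. Qed.

Lemma dmon_lin n : klinear (@dmon K V n).
Proof.
move=> k u v; apply: dpolyP => m; rewrite dcoef_lin /=.
by case: eqP => // _; rewrite scaler0 addr0.
Qed.

Lemma dshift_lin : klinear (@dshift K V).
Proof.
move=> k f g; apply: dpolyP => -[|m]; rewrite dcoef_lin //=.
by rewrite scaler0 addr0.
Qed.

Lemma dshift_dmon n v : dshift (dmon n v) = dmon n.+1 v :> dpoly V.
Proof. by apply: dpolyP => -[|m]. Qed.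

Lemma dcoef_fin f : exists N, forall n, (N <= n)%N -> f n = 0.
Proof. by apply/fin_suppP; case: f. Qed.

Lemma dpolyE N f : (forall n, (N <= n)%N -> f n = 0) ->
  f = \sum_(n < N) dmon n (f n).
Proof.
move=> fN; apply: dpolyP => m; rewrite (klin_sum (dcoef_lin m)) /=.
have [Nm|mN] := leqP N m.
  by rewrite fN// big1// => i _; rewrite gtn_eqF// (leq_trans _ Nm).
rewrite (bigD1 (Ordinal mN)) //= eqxx big1 ?addr0// => i.
by rewrite -val_eqE /= eq_sym => /negPf ->.
Qed.

Lemma dpoly_ind (P : dpoly V -> Prop) : (forall n v, P (dmon n v)) ->
  (forall k f g, P f -> P g -> P (k *: f + g)) -> forall f, P f.
Proof.
move=> Pm PD f; have [N fN] := dcoef_fin f; rewrite (dpolyE fN).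
elim/big_ind: _ => [|g h Pg Ph|//]; last by rewrite -[g]scale1r; apply: PD.
by have := PD (-1) _ _ (Pm 0 0) (Pm 0 0); rewrite scaleN1r addNr.
Qed.
End DPolynomials.

Section ConformalAlgebra.
Variables (K : fieldType) (A : comPzAlg K) (B : courant A).
Implicit Types u v w : AB B.
Notation inB := (@inB K A B).
Notation inA := (@inA K A B).

Lemma anchor_klin (a : A) : klinear (fun b : restr B => anchor (b : B) a).
Proof. by move=> k b c; rewrite anchor_linA cpa_scale1. Qed.

Lemma pairing_klinl (c : B) : klinear (fun b : restr B => pairing (b : B) c).
Proof. by move=> k b b'; rewrite pairing_linA cpa_scale1. Qed.

Lemma anchor0 (a : A) : anchor (0 : B) a = 0.
Proof. exact: klin0 (anchor_klin a). Qed.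

Lemma anchorr0 (b : B) : anchor b 0 = 0.
Proof. exact: (klin0 (anchor_lin b)). Qed.

Lemma bracket_klinr (b : B) : klinear (bracket b : restr B -> restr B).
Proof. by move=> k c c'; exact: bracket_linr. Qed.

Lemma bracket_klinl (b : B) : klinear (fun c : restr B => bracket (c : B) b :
  restr B).
Proof. by move=> k c c'; exact: bracket_linl. Qed.

Lemma bracket0r (b : B) : bracket b 0 = 0.
Proof. exact: klin0 (bracket_klinr b). Qed.

Lemma bracket0l (b : B) : bracket 0 b = 0.
Proof. exact: klin0 (bracket_klinl b). Qed.

Lemma anchor1 (b : B) : anchor b 1 = 0.
Proof.
have := anchor_der b 1 1; rewrite !mulr1 mul1r.
by move/(congr1 (fun x => x - anchor b 1)); rewrite subrr addrK.
Qed.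

Lemma cder1 : cder B 1 = 0.
Proof.
have := cder_der B 1 1; rewrite mulr1 scale1r.
by move/(congr1 (fun x => x - cder B 1)); rewrite subrr addrK.
Qed.

Lemma anchorZ (a c : A) (b : B) : anchor (a *: b) c = a * anchor b c.
Proof. by have := anchor_linA a b 0 c; rewrite anchor0 !addr0. Qed.

Lemma pairing0l (b : B) : pairing 0 b = 0.
Proof. exact: klin0 (pairing_klinl b). Qed.

Lemma pairing0r (b : B) : pairing b 0 = 0.
Proof. by rewrite pairing_sym pairing0l. Qed.

Lemma pairingZr (a : A) (b c : B) : pairing b (a *: c) = a * pairing b c.
Proof.
rewrite ![pairing b _]pairing_sym.
by have := pairing_linA a c 0 b; rewrite pairing0l !addr0.
Qed.

Lemma inA_lin : klinear inA.
Proof. by move=> k a b; apply: injective_projections => //=;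
  rewrite scaler0 addr0. Qed.

Lemma inB_lin : klinear (inB : restr B -> AB B).
Proof. by move=> k a b; apply: injective_projections => //=;
  rewrite scaler0 addr0. Qed.

Lemma cder_klin : klinear (cder B : A -> restr B).
Proof. exact: cder_lin. Qed.

Lemma prodAB_linl p v : klinear (prodAB p ^~ v).
Proof.
move=> k [a b] [a' b']; case: p => [|[|p]] /=; last by rewrite scaler0 addr0.
  apply: injective_projections; last exact: bracket_klinl.
  by rewrite /= anchor_klin anchor_lin scalerBr opprD addrACA.
apply: injective_projections; first exact: pairing_klinl.
by rewrite /= scaler0 addr0.
Qed.

Lemma prodAB_linr p u : klinear (prodAB p u).
Proof.
move=> k [a b] [a' b']; case: p => [|[|p]] /=; last by rewrite scaler0 addr0.
  apply: injective_projections; last exact: bracket_klinr.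
  by rewrite /= anchor_klin anchor_lin scalerBr opprD addrACA.
apply: injective_projections; last by rewrite /= scaler0 addr0.
by rewrite /= ![pairing u.2 _]pairing_sym; exact: pairing_klinl.
Qed.

Notation D := (@dshift K (AB B)).
Let D_lin : klinear D := @dshift_lin K (AB B).

Definition base u v : nat -> CAB B := fun p => dmon 0 (prodAB p u v).

Lemma base_fin u v : base u v \in @fin_supp K (CAB B).
Proof.
apply/fin_suppP; exists 2 => -[|[|p]]// _.
by rewrite /base /= (klin0 (@dmon_lin K (AB B) 0)).
Qed.

Lemma Y0ABE u m v : Y0AB u m v = iter m (sD D) (base u v).
Proof.
rewrite /Y0AB /base; elim: m => //= m ->; apply/funext => p.
by rewrite serN_deriv.
Qed.

(** Applying [- d/dx] to [f(-x)] gives [(df/dx)(-x)]; moving the sign change outside the derivatives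
    exhibits the second clause as a value of [skew]. *)
Lemma Y0monE n u m v : Y0mon n u m v =
  if n is 0 then iter m (sD D) (base u v)
  else skew D (iter m nsder (iter n (sD D) (base v u))).
Proof.
case: n => [|n]; first exact: Y0ABE.
rewrite /skew -iter_sder_opp -Y0ABE /Y0mon; congr sing_exp.
elim: m => //= m ->; apply/funext => p; exact: serN_deriv.
Qed.

Lemma base_linl k u u' v :
  base (k *: u + u') v = fun p => k *: base u v p + base u' v p.
Proof. by apply/funext => p; rewrite /base prodAB_linl dmon_lin. Qed.

Lemma base_linr k u v v' :
  base u (k *: v + v') = fun p => k *: base u v p + base u v' p.
Proof. by apply/funext => p; rewrite /base prodAB_linr dmon_lin. Qed.

Let iter_sD n := ser_linear_iter n (sD_linear D_lin).
Let iter_nsder n := ser_linear_iter n (@nsder_linear K (CAB B)).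

Lemma Y0mon_linl n m v p : klinear (fun u => Y0mon n u m v p).
Proof.
move=> k u u'; rewrite !Y0monE; case: n => [|n].
  by rewrite base_linl (iter_sD m).2 ?base_fin.
rewrite base_linr (iter_sD n.+1).2 ?base_fin// (iter_nsder m).2; last 2 first.
- by apply: (iter_sD n.+1).1; exact: base_fin.
- by apply: (iter_sD n.+1).1; exact: base_fin.
by rewrite (skew_lin D_lin) //; apply: (iter_nsder m).1;
  apply: (iter_sD n.+1).1;
  exact: base_fin.
Qed.

Lemma Y0mon_linr n u m p : klinear (fun v => Y0mon n u m v p).
Proof.
move=> k v v'; rewrite !Y0monE; case: n => [|n].
  by rewrite base_linr (iter_sD m).2 ?base_fin.
rewrite base_linl (iter_sD n.+1).2 ?base_fin// (iter_nsder m).2; last 2 first.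
- by apply: (iter_sD n.+1).1; exact: base_fin.
- by apply: (iter_sD n.+1).1; exact: base_fin.
by rewrite (skew_lin D_lin) //; apply: (iter_nsder m).1;
  apply: (iter_sD n.+1).1;
  exact: base_fin.
Qed.

Lemma prodCABE N M p (f g : CAB B) : (forall n, (N <= n)%N -> f n = 0) ->
  (forall n, (M <= n)%N -> g n = 0) ->
  prodCAB p f g = \sum_(n < N) \sum_(m < M) Y0mon n (f n) m (g m) p.
Proof.
move=> fN gM; have gE n : \sum_(m \in [set: nat]) Y0mon n (f n) m (g m) p =
    \sum_(m < M) Y0mon n (f n) m (g m) p.
  by apply: fsum_nat => m Mm; rewrite gM// (klin0 (Y0mon_linr _ _ _ _)).
rewrite /prodCAB (@fsum_nat _ N) => [|n Nn]; first by apply: eq_bigr => n _.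
by rewrite gE big1// => m _; rewrite fN// (klin0 (Y0mon_linl _ _ _ _)).
Qed.

Lemma prodCAB_linl p g : klinear (fun f : CAB B => prodCAB p f g).
Proof.
move=> k f f'; have [M gM] := dcoef_fin g.
have [N fN] := dcoef_fin f; have [N' fN'] := dcoef_fin f'.
have {}fN n : (maxn N N' <= n)%N -> f n = 0.
  by rewrite geq_max => /andP[/fN].
have {}fN' n : (maxn N N' <= n)%N -> f' n = 0.
  by rewrite geq_max => /andP[_ /fN'].
have ffN n : (maxn N N' <= n)%N -> (k *: f + f') n = 0.
  by move=> Nn; rewrite dcoef_lin fN ?fN'// scaler0 addr0.
rewrite (prodCABE p fN gM) (prodCABE p fN' gM) (prodCABE p ffN gM).
rewrite scaler_sumr -big_split; apply: eq_bigr => n _ /=.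
rewrite scaler_sumr -big_split; apply: eq_bigr => m _ /=.
exact: Y0mon_linl.
Qed.

Lemma prodCAB_linr p f : klinear (prodCAB p f : CAB B -> CAB B).
Proof.
move=> k g g'; have [M fM] := dcoef_fin f.
have [N gN] := dcoef_fin g; have [N' gN'] := dcoef_fin g'.
have {}gN n : (maxn N N' <= n)%N -> g n = 0.
  by rewrite geq_max => /andP[/gN].
have {}gN' n : (maxn N N' <= n)%N -> g' n = 0.
  by rewrite geq_max => /andP[_ /gN'].
have ggN n : (maxn N N' <= n)%N -> (k *: g + g') n = 0.
  by move=> Nn; rewrite dcoef_lin gN ?gN'// scaler0 addr0.
rewrite (prodCABE p fM gN) (prodCABE p fM gN') (prodCABE p fM ggN).
rewrite scaler_sumr -big_split; apply: eq_bigr => n _ /=.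
rewrite scaler_sumr -big_split; apply: eq_bigr => m _ /=.
exact: Y0mon_linr.
Qed.

Lemma dmon_vanish n (w : AB B) i : (n.+1 <= i)%N -> dmon n w i = 0.
Proof. by move=> ni; rewrite /= gtn_eqF. Qed.

Lemma prodCAB_dmon p n u m v :
  prodCAB p (dmon n u) (dmon m v) = Y0mon n u m v p.
Proof.
rewrite (prodCABE p (@dmon_vanish n u) (@dmon_vanish m v)).
rewrite (bigD1 ord_max)//= (bigD1 ord_max)//= !eqxx.
rewrite big1 => [|i /negPf ni]; last first.
  by rewrite -val_eqE /= in ni; rewrite ni (klin0 (Y0mon_linr _ _ _ _)).
rewrite addr0 big1 ?addr0// => i /negPf ni; apply: big1 => j _.
by rewrite -val_eqE /= in ni; rewrite ni (klin0 (Y0mon_linl _ _ _ _)).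
Qed.
End ConformalAlgebra.

(** * The vertex Lie algebra C *)

Section VertexLieAlgebra.
Variables (K : fieldType) (A : comPzAlg K) (B : courant A).
Hypothesis pcharK : [pchar K] =i pred0.
Implicit Types u v w : AB B.
Notation inB := (@inB K A B).
Notation inA := (@inA K A B).
Notation piC := (fun f : CAB B => \pi_(CB B) f : CB B).
Notation D := (@dshift K (AB B)).
Let D_lin : klinear D := @dshift_lin K (AB B).

Lemma piC_lin : klinear piC.
Proof.
move=> k x y; rewrite [LHS]pi_quotD; congr (_ + _).
exact: (pi_qscale (range (@dhat K A B)) k x).
Qed.

Lemma dhat_dmon n a : dhat B (dmon n a) = dmon n (inB (cder B a)) - dmon n.+1
  (inA a).
Proof.
have d0 m : dmon m (inB (cder B 0)) - dmon m.+1 (inA 0) = 0 :> CAB B.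
  rewrite (klin0 (cder_klin B)) (klin0 (@inA_lin K A B)) (klin0 (@inB_lin K A
    B)).
  by rewrite !(klin0 (@dmon_lin K (AB B) _)) subr0.
rewrite /dhat (@fsum_nat _ n.+1) => [|m nm]; last by rewrite /= gtn_eqF.
rewrite (bigD1 ord_max)//= eqxx big1 ?addr0// => i /negPf ni.
by rewrite -val_eqE /= in ni; rewrite ni.
Qed.

Lemma dhatE N (f : dpoly A) : (forall n, (N <= n)%N -> f n = 0) ->
  dhat B f = \sum_(n < N) dhat B (dmon n (f n)).
Proof.
move=> fN; rewrite /dhat (@fsum_nat _ N) => [|n Nn].
  by apply: eq_bigr => n _; rewrite -dhat_dmon.
rewrite fN // (klin0 (cder_klin B)) (klin0 (@inA_lin K A B)).
by rewrite (klin0 (@inB_lin K A B)) !(klin0 (@dmon_lin K (AB B) _)) subr0.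
Qed.

(** Every value of [dhat] is a sum of its values on the [D^n (x) a], so the relations need checking
    only there. *)
Lemma CB_lift (W : lmodType K) (F : CAB B -> W) : klinear F ->
  (forall n a, F (dmon n (inB (cder B a))) = F (dmon n.+1 (inA a))) ->
  forall f g, piC f = piC g -> F f = F g.
Proof.
move=> F_lin FE f g /quot_eqP fg; apply/eqP; rewrite -subr_eq0 -(klinB F_lin).
apply/eqP; move: fg; move: (f - g).
apply: (lspan_ind (P := fun f => F f = 0)); first exact: klin0.
move=> k _ y [c _ <-] Fy; rewrite F_lin Fy addr0.
have [N cN] := dcoef_fin c; rewrite (dhatE cN) (klin_sum F_lin) big1 ?scaler0//.
by move=> i _; rewrite dhat_dmon (klinB F_lin) FE subrr.
Qed.

Lemma piC_cder n a : piC (dmon n (inB (cder B a))) = piC (dmon n.+1 (inA a)).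
Proof.
apply/quot_eqP; rewrite -dhat_dmon; apply: lspan_gen.
by exists (dmon n a).
Qed.

Lemma DCB_pi f : DCB (piC f) = piC (D f).
Proof.
rewrite /DCB -lock; apply: (CB_lift (F := fun f => piC (D f))).
- by move=> k x y; rewrite D_lin piC_lin.
- by move=> n a; rewrite !dshift_dmon piC_cder.
- by rewrite reprK.
Qed.

Lemma CB_ind (P : CB B -> Prop) : (forall n u, P (classCB n u)) ->
  (forall k x y, P x -> P y -> P (k *: x + y)) -> forall x, P x.
Proof.
move=> Pm PD x; rewrite -[x]reprK; move: (repr x) => {}x.
apply: (dpoly_ind (P := fun f => P (piC f))) => // k f g Pf Pg.
by rewrite piC_lin; apply: PD.
Qed.

Lemma DCB_lin : klinear (@DCB K A B).
Proof.
move=> k x y; rewrite -[x]reprK -[y]reprK -piC_lin !DCB_pi D_lin.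
exact: piC_lin.
Qed.

Lemma DCB_class n u : DCB (classCB n u) = classCB n.+1 u.
Proof. by rewrite DCB_pi dshift_dmon. Qed.

Lemma class_cder n a : classCB n (inB (cder B a)) = classCB n.+1 (inA a).
Proof. exact: piC_cder. Qed.

Lemma class_lin n : klinear (@classCB K A B n).
Proof. by move=> k u v; rewrite /classCB dmon_lin piC_lin. Qed.

Definition cbase u v : nat -> CB B := fun p => classCB 0 (prodAB p u v).

Lemma cbase_fin u v : cbase u v \in @fin_supp K (CB B).
Proof. exact: fin_supp_map piC_lin (base_fin u v). Qed.

(** Coefficient 0 is the axiom [bracket_sym], once [class_cder] turns [D] of the pairing into its
    [cder]; coefficient 1 is [pairing_sym]. *)
Lemma cbase_skew u v : cbase u v = skew (@DCB K A B) (cbase v u).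
Proof.
have v2 n : (2 <= n)%N -> ser_opp (cbase v u) n = 0.
  by case: n => [|[|n]]// _;
    rewrite /ser_opp /cbase /= (klin0 (class_lin 0)) scaler0.
apply/funext => p; rewrite /skew (sing_expE DCB_lin _ v2).
rewrite !big_ord_recl big_ord0 addr0 /= /bump /= addn0 addn1 !invr1 !scale1r.
case: p => [|[|p]].
- rewrite /ser_opp expr1 sqrrN expr1n scale1r scaleN1r /cbase DCB_class
  -class_cder /=.
  rewrite -scaleN1r -class_lin; congr classCB;
    apply: injective_projections => /=.
    by rewrite addr0 scaleN1r opprB.
  by rewrite scaleN1r -(bracket_sym v.2 u.2) addKr.
- rewrite (v2 2)// (klin0 DCB_lin) addr0 /ser_opp sqrrN expr1n scale1r /cbase
  /=.
  by rewrite pairing_sym.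
- by rewrite !v2 // (klin0 DCB_lin) addr0 /cbase /= (klin0 (class_lin 0)).
Qed.

(** The closed form of [Y(D^n u, x) D^m v] in [C]. *)
Definition Yc n u m v : nat -> CB B :=
  iter m (sD (@DCB K A B)) (iter n nsder (cbase u v)).


Let piC_D f : piC (D f) = DCB (piC f) := esym (DCB_pi f).

Lemma Yc_fin n u m v : Yc n u m v \in @fin_supp K (CB B).
Proof.
apply: fin_supp_iter (fin_supp_sD DCB_lin) _.
by apply: fin_supp_iter (@fin_supp_nsder _ _) _; exact: cbase_fin.
Qed.

(** For [n >= 1], [skew_iter] exchanges the operators [(d/dx)^m] and [(D - d/dx)^n], and
    [cbase_skew] puts [u] and [v] back in order. *)
Lemma pi_Y0mon n u m v p : piC (Y0mon n u m v p) = Yc n u m v p.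
Proof.
have sDE k x y : (fun p => piC (iter k (sD D) (base x y) p)) =
    iter k (sD (@DCB K A B)) (cbase x y).
  exact: (iter_sD_map piC_lin piC_D).
rewrite Y0monE; case: n => [|n]; first exact: (congr1 (@^~ p) (sDE m u v)).
set f := iter n.+1 _ _.
have ff : f \in @fin_supp K (CAB B).
  exact: fin_supp_iter (fin_supp_sD D_lin) (base_fin v u).
have mff : iter m nsder f \in @fin_supp K (CAB B).
  exact: fin_supp_iter (@fin_supp_nsder _ _) ff.
have -> : piC (skew D (iter m nsder f) p) =
    skew (@DCB K A B) (fun q => piC (iter m nsder f q)) p.
  exact: (congr1 (@^~ p) (skew_map D_lin DCB_lin piC_lin piC_D mff)).
rewrite (iter_nsder_map piC_lin) sDE.
rewrite -(iter_sD_iter_nsder DCB_lin n.+1 m (cbase v u)).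
rewrite (skew_iter DCB_lin pcharK n.+1 m (cbase_fin v u)).
by rewrite -cbase_skew.
Qed.

Let class0 n : classCB n 0 = 0 :> CB B.
Proof. exact: klin0 (class_lin n). Qed.

Lemma bracket_cderl (a : A) (b : B) : bracket (cder B a) b = 0.
Proof.
have := bracket_sym (cder B a) b; rewrite bracket_cder pairing_sym pairing_cder.
by move=> /eqP; rewrite -subr_eq0 addrK => /eqP.
Qed.

Lemma cbase_cderl a v : cbase (inB (cder B a)) v = nsder (cbase (inA a) v).
Proof.
apply/funext => -[|[|[|p]]]; rewrite /nsder /sder /cbase /=.
- by rewrite scale0r oppr0 anchor_cder anchorr0 subr0 bracket_cderl class0.
- rewrite scale1r -scaleN1r -(klinZ (class_lin 0)); congr classCB.
  apply: injective_projections; rewrite /= ?bracket0l ?scaler0//.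
  by rewrite anchor0 sub0r scaleN1r opprK pairing_sym pairing_cder.
- by rewrite pairing0l !class0 scaler0 oppr0.
- by rewrite class0 scaler0 oppr0.
Qed.

Lemma cbase_cderr u a : cbase u (inB (cder B a)) = sD (@DCB K A B) (cbase u
  (inA a)).
Proof.
apply/funext => -[|[|[|p]]]; rewrite /sD /sder /cbase /= ?DCB_class.
- rewrite scale0r addr0 anchor_cder anchorr0 subr0 bracket_cder anchor0 subr0.
  by rewrite bracket0r; exact: class_cder.
- rewrite scale1r pairing0r class0 add0r pairing_cder anchor0 subr0.
  by rewrite bracket0r.
- by rewrite pairing0r !class0 scaler0 addr0.
- by rewrite !class0 scaler0 addr0.
Qed.

Lemma prodCB_pi p f g : prodCB p (piC f) (piC g) = piC (prodCAB p f g).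
Proof.
(* The representatives are exchanged one argument at a time, the left one by [cbase_cderl] and the
   right one by [cbase_cderr]. *)
rewrite /prodCB -lock; transitivity (piC (prodCAB p f (repr (piC g)))).
  apply: (CB_lift (F := fun f => piC (prodCAB p f _))); last by rewrite reprK.
    by move=> k x y; rewrite (prodCAB_linl p _ k x y) piC_lin.
  move=> n a; elim/dpoly_ind: (repr _) => [m v|k x y IHx IHy].
    rewrite !prodCAB_dmon !pi_Y0mon /Yc cbase_cderl.
    by rewrite -[nsder (cbase _ _)]/(iter 1 nsder _) -iterD addn1.
  by rewrite !(prodCAB_linr p _ k x y) !piC_lin IHx IHy.
apply: (CB_lift (F := fun g => piC (prodCAB p _ g))); last by rewrite reprK.
  by move=> k x y; rewrite (prodCAB_linr p _ k x y) piC_lin.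
move=> m a; elim/dpoly_ind: f => [n u|k x y IHx IHy].
  rewrite !prodCAB_dmon !pi_Y0mon /Yc cbase_cderr.
  by rewrite (sD_iter_nsder DCB_lin) iterSr.
by rewrite !(prodCAB_linl p _ k x y) !piC_lin IHx IHy.
Qed.

Lemma prodCB_class p n u m v :
  prodCB p (classCB n u) (classCB m v) = Yc n u m v p.
Proof. by rewrite prodCB_pi prodCAB_dmon pi_Y0mon. Qed.

Lemma prodCB_linl p y : klinear (fun x : CB B => prodCB p x y).
Proof.
move=> k x x'; rewrite -[x]reprK -[x']reprK -[y]reprK -piC_lin !prodCB_pi.
by rewrite (prodCAB_linl p _ k) piC_lin.
Qed.

Lemma prodCB_linr p x : klinear (prodCB p x : CB B -> CB B).
Proof.
move=> k y y'; rewrite -[y]reprK -[y']reprK -[x]reprK -piC_lin !prodCB_pi.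
by rewrite (prodCAB_linr p _ k) piC_lin.
Qed.

Lemma prodCB_Dl p (x y : CB B) : prodCB p (DCB x) y = - sder (fun q => prodCB q
  x y) p.
Proof.
have sder_l z : klinear (fun x : CB B => - sder (fun q => prodCB q x z) p).
  move=> k x1 x2; rewrite /sder prodCB_linl scalerDr scalerA mulrC -scalerA.
  by rewrite opprD scalerN.
have sder_r z : klinear (fun y : CB B => - sder (fun q => prodCB q z y) p).
  move=> k x1 x2; rewrite /sder prodCB_linr scalerDr scalerA mulrC -scalerA.
  by rewrite opprD scalerN.
elim/CB_ind: x => [n u|k x x' IHx IHx']; last first.
  by rewrite DCB_lin prodCB_linl (sder_l y k x x') IHx IHx'.
elim/CB_ind: y => [m v|k y y' IHy IHy']; last first.
  by rewrite prodCB_linr (sder_r _ k y y') IHy IHy'.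
rewrite DCB_class prodCB_class /Yc -[iter n.+1 _ _]/(nsder (iter n _ _)).
rewrite (iter_sD_nsder DCB_lin) /nsder; congr (- sder _ _).
by apply/funext => q; rewrite prodCB_class.
Qed.

Lemma prodCB_Dr p (x y : CB B) :
  prodCB p x (DCB y) = DCB (prodCB p x y) + sder (fun q => prodCB q x y) p.
Proof.
have sder_l z : klinear (fun x : CB B => DCB (prodCB p x z) + sder (fun q =>
  prodCB q x z) p).
  move=> k x1 x2; rewrite /sder !prodCB_linl DCB_lin scalerDr.
  by rewrite scalerA mulrC -scalerA addrACA scalerDr.
have sder_r z : klinear (fun y : CB B => DCB (prodCB p z y) + sder (fun q =>
  prodCB q z y) p).
  move=> k x1 x2; rewrite /sder !prodCB_linr DCB_lin scalerDr.
  by rewrite scalerA mulrC -scalerA addrACA scalerDr.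
elim/CB_ind: x => [n u|k x x' IHx IHx']; last first.
  by rewrite prodCB_linl (sder_l y k x x') IHx IHx'.
elim/CB_ind: y => [m v|k y y' IHy IHy']; last first.
  by rewrite DCB_lin prodCB_linr (sder_r _ k y y') IHy IHy'.
rewrite DCB_class !prodCB_class /Yc /= {1}/sD; congr (_ + sder _ _).
by apply/funext => q; rewrite prodCB_class.
Qed.

Lemma prodCB_fin (x y : CB B) : (fun p => prodCB p x y) \in @fin_supp K (CB B).
Proof.
elim/CB_ind: x => [n u|k x x' IHx IHx']; last first.
  have -> : (fun p => prodCB p (k *: x + x') y) =
      (fun p => k *: prodCB p x y + prodCB p x' y).
    by apply/funext => p; rewrite prodCB_linl.
  exact: fin_supp_comb.
elim/CB_ind: y => [m v|k y y' IHy IHy']; last first.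
  have -> : (fun p => prodCB p (classCB n u) (k *: y + y')) =
      (fun p => k *: prodCB p (classCB n u) y + prodCB p (classCB n u) y').
    by apply/funext => p; rewrite prodCB_linr.
  exact: fin_supp_comb.
have -> : (fun p => prodCB p (classCB n u) (classCB m v)) = Yc n u m v.
  by apply/funext => p; rewrite prodCB_class.
exact: Yc_fin.
Qed.

Lemma prodCB_skew p (x y : CB B) :
  prodCB p x y = sing_exp (@DCB K A B) (ser_opp (fun q => prodCB q y x)) p.
Proof.
have comb_l k (z y1 y2 : CB B) : (fun q => prodCB q (k *: y1 + y2) z) =
    (fun q => k *: prodCB q y1 z + prodCB q y2 z).
  by apply/funext => q; rewrite prodCB_linl.
have comb_r k (z y1 y2 : CB B) : (fun q => prodCB q z (k *: y1 + y2)) =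
    (fun q => k *: prodCB q z y1 + prodCB q z y2).
  by apply/funext => q; rewrite prodCB_linr.
rewrite -[RHS]/(skew (@DCB K A B) _ p).
elim/CB_ind: x => [n u|k x x' IHx IHx']; last first.
  rewrite comb_r (skew_lin DCB_lin k (prodCB_fin y x) (prodCB_fin y x')).
  by rewrite prodCB_linl IHx IHx'.
elim/CB_ind: y => [m v|k y y' IHy IHy']; last first.
  rewrite comb_l (skew_lin DCB_lin k (prodCB_fin y _) (prodCB_fin y' _)).
  by rewrite prodCB_linr IHy IHy'.
have -> : (fun q => prodCB q (classCB m v) (classCB n u)) = Yc m v n u.
  by apply/funext => q; rewrite prodCB_class.
rewrite prodCB_class /Yc (skew_iter DCB_lin pcharK n m (cbase_fin v u)).
by rewrite -cbase_skew.
Qed.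

Lemma CB_gen x : x \in lspan [set y : CB B | exists n g,
  range (@classCB K A B 0) g /\ y = iter n (@DCB K A B) g].
Proof.
elim/CB_ind: x => [n u|k x y IHx IHy]; last by rewrite rpredD ?rpredZ.
apply: lspan_gen; exists n, (classCB 0 u); split; first by exists u.
by elim: n => //= n <-; rewrite DCB_class.
Qed.
End VertexLieAlgebra.

(** * The quotient of S(C) *)

Section QuotientMaps.
Variables (K : fieldType) (S : comAlgType K) (E : set S).
Notation q := (fun x : S => \pi_(quotalg E) x : quotalg E).

Lemma quotalg_lin : klinear q.
Proof.
move=> k x y; rewrite [LHS]pi_quotD; congr (_ + _).
exact: (pi_qscale (ideal_gen E) k x).
Qed.

Lemma quotalgM x y : q (x * y) = q x * q y.
Proof. exact: pi_qmul. Qed.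

Lemma quotalg1 : q 1 = 1.
Proof. by []. Qed.

Lemma quotalg_eqP x y : reflect (q x = q y) (x - y \in lspan (ideal_gen E)).
Proof. exact: quot_eqP. Qed.

Lemma quotalg_prod (I : Type) (r : seq I) (F : I -> S) :
  q (\prod_(i <- r) F i) = \prod_(i <- r) q (F i).
Proof. exact: (big_morph q quotalgM quotalg1). Qed.

Lemma quotalg_mul_linl (x : quotalg E) : klinear (fun y : quotalg E => y * x :
  quotalg E).
Proof. by move=> k y z; rewrite mulrDl; congr (_ + _); apply/esym;
  exact: qscaleAl. Qed.

Lemma quotalg_mul_linr (x : quotalg E) : klinear (fun y : quotalg E => x * y :
  quotalg E).
Proof. by move=> k y z; rewrite ![x * _]mulrC quotalg_mul_linl. Qed.
End QuotientMaps.

(** * Evaluation of [C] in the square-zero extension [A + B] *)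

Section Evaluation.
Variables (K : fieldType) (A : comPzAlg K) (B : courant A).
Notation inA := (@inA K A B).
Notation inB := (@inB K A B).
Notation T := (sqzero B).

Definition scalarA (k : K) : A := k *: (1 : A).
Lemma scalarA_zmod : zmod_morphism scalarA.
Proof. by move=> k l; rewrite /scalarA scalerBl. Qed.
Lemma scalarA_monoid : monoid_morphism scalarA.
Proof.
split=> [|k l]; first exact: scale1r.
by rewrite /scalarA -scalerA cpa_scale1.
Qed.
HB.instance Definition _ := GRing.isZmodMorphism.Build K A scalarA scalarA_zmod.
HB.instance Definition _ :=
  GRing.isMonoidMorphism.Build K A scalarA scalarA_monoid.

(* The map of [C] to the square-zero extension [A + B] that sends [a], [b] and
   [D a] to [a], [b] and [cder a], and kills the degrees 2 and more. *)
Definition CAB_eval (f : CAB B) : T :=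
  ((f 0%N).1, (f 0%N).2 + cder B (f 1%N).1).
Definition CB_eval (c : CB B) : T := CAB_eval (repr c).

Definition sqzero_der (x : T) : T := (0, cder B x.1).

Lemma CAB_eval_lin : klinear (CAB_eval : CAB B -> A * restr B).
Proof.
move=> k x y; apply: injective_projections => //=.
by rewrite (cder_klin B) [RHS]/= scalerDr addrACA.
Qed.

(** The relation between [cder a] and [D a] is respected because [D a] is sent to [cder a]; in the
    higher degrees both sides are sent to 0. *)
Lemma CB_evalE f : CB_eval (\pi_(CB B) f) = CAB_eval f.
Proof.
apply: (CB_lift CAB_eval_lin); last by rewrite reprK.
move=> n a; apply: injective_projections; rewrite /CAB_eval /=;
  case: n => [|[|n]] //=.
by rewrite (klin0 (cder_klin B)) addr0 add0r.
Qed.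

Lemma CB_eval_lin k x y :
  CB_eval (k *: x + y) = sqzero_inl B (scalarA k) * CB_eval x + CB_eval y.
Proof.
rewrite -[x]reprK -[y]reprK -piC_lin !CB_evalE [LHS]CAB_eval_lin.
apply: injective_projections => /=; first by rewrite cpa_scale1.
by rewrite scaler0 addr0.
Qed.

Lemma CB_eval_class0 u : CB_eval (classCB 0 u) = u.
Proof.
rewrite CB_evalE /CAB_eval /= (klin0 (cder_klin B)).
by apply: injective_projections => //=; rewrite addr0.
Qed.

Lemma CB_eval_D c : CB_eval (DCB c) = sqzero_der (CB_eval c).
Proof.
rewrite -[c]reprK DCB_pi !CB_evalE.
by apply: injective_projections => //=; rewrite add0r.
Qed.

Lemma sqzero_derM x y :
  sqzero_der (x * y) = sqzero_der x * y + x * sqzero_der y.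
Proof.
apply: injective_projections => /=; first by rewrite mul0r mulr0 addr0.
by rewrite cder_der !scale0r add0r addr0 addrC.
Qed.

Lemma sqzero_der_lin k x y : sqzero_der (sqzero_inl B (scalarA k) * x + y) =
  sqzero_inl B (scalarA k) * sqzero_der x + sqzero_der y.
Proof.
apply: injective_projections => /=; first by rewrite mulr0 addr0.
by rewrite !scaler0 addr0 cpa_scale1 cder_lin.
Qed.
End Evaluation.

(** * The quotient by [I_B] and its induced operations *)

Section CourantQuotient.
Variables (K : fieldType) (A : comPzAlg K) (B : courant A).
Hypothesis pcharK : [pchar K] =i pred0.
Variables (S : comAlgType K) (inj : CB B -> S).
Hypothesis inj_lin : klinear inj.
Hypothesis S_ind : forall P : S -> Prop,
  P 1 -> (forall v x, P x -> P (inj v * x)) ->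
  (forall k x y, P x -> P y -> P (k *: x + y)) -> forall x, P x.
Variables (DS : S -> S) (Z : CB B -> nat -> S -> S) (P : nat -> S -> S -> S).
Hypothesis DS_der : derivation DS.
Hypothesis DSE : forall u, DS (inj u) = inj (DCB u).
Hypothesis Z_der : forall u n, derivation (Z u n).
Hypothesis ZE : forall u n v, Z u n (inj v) = inj (prodCB n u v).
Hypothesis P_der : forall n a, derivation (P n a).
Hypothesis PE : forall n a u, P n a (inj u) = skew_prod DS Z n a u.

Notation inA := (@inA K A B).
Notation inB := (@inB K A B).
Let SA (a : A) : S := inj (classCB 0 (inA a)).
Let SB (b : B) : S := inj (classCB 0 (inB b)).
Let E0 : set S :=
  [set` lspan [set x | x = SA 1 - 1 \/
                      exists a a', x = SA a * SA a' - SA (a * a')]].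
Let E1 : set S :=
  [set` lspan [set x | exists a (b : B), x = SA a * SB b - SB (a *: b)]].
Let E : set S := [set x + y | x in E0 & y in E1].
Let DE : set S := [set` lspan [set y | exists m x, E x /\ y = iter m DS x]].
Let I := lspan (ideal_gen DE).

Let E0E x : E0 x -> E x.
Proof.
by move=> Ex; exists x => //; exists 0; rewrite ?addr0//; exact: rpred0.
Qed.
Let E1E x : E1 x -> E x.
Proof.
by move=> Ex; exists 0; [exact: rpred0|exists x; rewrite ?add0r].
Qed.
Let EI x : E x -> x \in I.
Proof.
move=> Ex; apply: lspan_gen; exists 1 => //; exists x; last exact: mul1r.
by apply: lspan_gen; exists 0, x.
Qed.

Let relA1 : SA 1 - 1 \in I.
Proof. by apply/EI/E0E; apply: lspan_gen; left. Qed.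
Let relAA a a' : SA a * SA a' - SA (a * a') \in I.
Proof. by apply/EI/E0E; apply: lspan_gen; right; exists a, a'. Qed.
Let relAB a (b : B) : SA a * SB b - SB (a *: b) \in I.
Proof. by apply/EI/E1E; apply: lspan_gen; exists a, b. Qed.

Let SA_lin : klinear SA.
Proof. by move=> k a a'; rewrite /SA inA_lin class_lin inj_lin. Qed.
Let SB_lin : klinear (SB : restr B -> S).
Proof. by move=> k b b'; rewrite /SB inB_lin class_lin inj_lin. Qed.

Lemma prodCB_class0 p u v : prodCB p (classCB 0 u) (classCB 0 v) =
  classCB 0 (prodAB p u v) :> CB B.
Proof. exact: prodCB_class. Qed.

Let Z_A0 u a : Z (classCB 0 u) 0 (SA a) = SA (anchor (u.2 : B) a).
Proof. by rewrite ZE prodCB_class0 /= anchor0 subr0 bracket0r. Qed.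
Let Z_B0 u (b : B) : Z (classCB 0 u) 0 (SB b) =
  SB (bracket (u.2 : B) b) - SA (anchor b u.1).
Proof.
rewrite ZE prodCB_class0 /= anchorr0 sub0r [RHS]addrC -[- SA _]scaleN1r
  -inj_lin -class_lin.
congr (inj (classCB 0 _)); apply: injective_projections => /=.
  by rewrite addr0 scaleN1r.
by rewrite scaler0 add0r.
Qed.
Let Z_A1 u p a : Z (classCB 0 u) p.+1 (SA a) = 0.
Proof.
rewrite ZE prodCB_class0; case: p => [|p] /=.
  by rewrite pairing0r (klin0 (class_lin 0)) (klin0 inj_lin).
by rewrite (klin0 (class_lin 0)) (klin0 inj_lin).
Qed.
Let Z_B1 u (b : B) : Z (classCB 0 u) 1 (SB b) = SA (pairing (u.2 : B) b).
Proof. by rewrite ZE prodCB_class0. Qed.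
Let Z_B2 u p (b : B) : Z (classCB 0 u) p.+2 (SB b) = 0.
Proof. by rewrite ZE prodCB_class0 /= (klin0 (class_lin 0)) (klin0 inj_lin).
  Qed.

Let Z_E u n x : E x -> Z (classCB 0 u) n x \in I.
Proof.
have ZB x' y : Z (classCB 0 u) n (x' - y) =
    Z (classCB 0 u) n x' - Z (classCB 0 u) n y.
  exact: klinB (Z_der _ _).1 _ _.
move=> [x0 E0x [x1 E1x <-]]; rewrite (klinD (Z_der _ _).1); apply: rpredD.
  move: E0x => /=; apply: lspan_linear (Z_der _ _).1 _ _.
  move=> _ [->|[a [a' ->]]].
    rewrite ZB (der1 (Z_der _ _)) subr0; case: n {ZB} => [|n]; last first.
      by rewrite Z_A1 rpred0.
    by rewrite Z_A0 anchor1 (klin0 SA_lin) rpred0.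
  rewrite ZB (Z_der _ _).2; case: n {ZB} => [|n]; last first.
    by rewrite !Z_A1 mul0r mulr0 addr0 subr0 rpred0.
  rewrite !Z_A0 anchor_der (klinD SA_lin) opprD addrACA.
  by apply: rpredD; apply: relAA.
move: E1x => /=; apply: lspan_linear (Z_der _ _).1 _ _.
move=> _ [a [b ->]]; rewrite ZB (Z_der _ _).2; case: n {ZB} => [|[|n]].
- rewrite Z_A0 !Z_B0 bracket_scale anchorZ (klinD SB_lin).
  (* Besides two relators of [E1], one of [E0] appears: the component [u.1] in [A] acts on [B] with
     values in [A], by [- anchor b u.1]. *)
  have -> (p q r s t y z w : S) :
      p * q + r * (s - t) - (y + z - w) = (p * q - z) + ((r * s - y) - (r * t -
        w)).
    by ring.
  apply: rpredD; first exact: relAB.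
  by apply: rpredB; [exact: relAB|exact: relAA].
- by rewrite Z_A1 !Z_B1 mul0r add0r pairingZr; apply: relAA.
- by rewrite Z_A1 !Z_B2 mul0r mulr0 addr0 subr0 rpred0.
Qed.

Notation Q := (quotalg DE).
Notation q := (fun x : S => \pi_Q x : Q).

Let C_gen := @CB_gen K A B.
Let Z_E' g n x : range (@classCB K A B 0) g -> E x -> Z g n x \in I.
Proof. by move=> [u _ <-]; exact: Z_E. Qed.

Let I_D' := dideal_D DS_der (E := E).
Let I_Z' := dideal_mode inj_lin S_ind (@prodCB_linl _ _ _ pcharK) (prodCB_Dl
  pcharK)
  (prodCB_Dr pcharK) DS_der DSE Z_der ZE C_gen Z_E'.
Let I_P' := dideal_prod inj_lin S_ind (@prodCB_linl _ _ _ pcharK) (prodCB_Dl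
  pcharK)
  (prodCB_Dr pcharK) (prodCB_fin pcharK) DS_der DSE Z_der ZE P_der PE C_gen
    Z_E'.
Let P_inj' := prod_inj inj_lin S_ind (@DCB_lin _ _ _) (prodCB_fin pcharK)
  (prodCB_skew pcharK) DS_der DSE Z_der ZE P_der PE.
Let P_linl' := prod_linl inj_lin S_ind
  (prodCB_fin pcharK) DS_der Z_der ZE P_der PE.

Let DQ : Q -> Q := lift_op1 Q DS.
Let PQ n : Q -> Q -> Q := lift_op2 Q (P n).

Let DQ_pi x : DQ (q x) = q (DS x).
Proof.
rewrite /DQ -lock; apply/quotalg_eqP; rewrite -(klinB DS_der.1).
by apply: I_D'; apply: quot_reprP.
Qed.

Let PQ_pi n u x : PQ n (q (inj u)) (q x) = q (Z u n x).
Proof.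
rewrite /PQ -lock; apply/quotalg_eqP.
set i := repr _; set y := repr _.
(* The representative [i] of the class of [inj u] need not lie in [C], so the left factor is
   corrected through stability of [I] under [P], and the right one through stability under
   [Z u n]. *)
have -> : P n i y - Z u n x = P n (i - inj u) y + Z u n (y - x).
  rewrite (klinB (P_linl' n y)) (klinB (Z_der u n).1) P_inj'.
  by rewrite addrA subrK.
by apply: rpredD; [apply: I_P'|apply: I_Z']; apply: quot_reprP.
Qed.

Let qA a : Q := q (SA a).
Let qB (b : B) : Q := q (SB b).
Let qDB n (b : B) : Q := q (inj (classCB n (inB b))).

Lemma quot_bracket (u v : B) : qB (bracket u v) = PQ 0 (qB u) (qB v).
Proof. by rewrite /qB PQ_pi Z_B0 /= anchorr0 (klin0 SA_lin) subr0. Qed.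

Lemma quot_pairing (u v : B) : qA (pairing u v) = PQ 1 (qB u) (qB v).
Proof. by rewrite /qA /qB PQ_pi Z_B1. Qed.

Lemma quot_anchor (u : B) a : qA (anchor u a) = PQ 0 (qB u) (qA a).
Proof. by rewrite /qA /qB PQ_pi Z_A0. Qed.

Lemma quot_cder a : qB (cder B a) = DQ (qA a).
Proof. by rewrite /qA /qB DQ_pi DSE DCB_class -class_cder. Qed.

Lemma quotA_lin : klinear qA.
Proof. by move=> k a a'; rewrite /qA SA_lin quotalg_lin. Qed.

Lemma quotB_lin : klinear (qB : restr B -> Q).
Proof. by move=> k b b'; rewrite /qB SB_lin quotalg_lin. Qed.

Lemma quotA1 : qA 1 = 1.
Proof. by rewrite /qA -quotalg1; apply/quotalg_eqP; exact: relA1. Qed.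

Lemma quotAM a a' : qA (a * a') = qA a * qA a'.
Proof. by rewrite /qA -quotalgM; apply/esym/quotalg_eqP. Qed.

Lemma quotAB a (b : B) : qB (a *: b) = qA a * qB b.
Proof. by rewrite /qA /qB -quotalgM; apply/esym/quotalg_eqP. Qed.

Lemma DQ_lin : klinear DQ.
Proof.
move=> k x y; rewrite -[x]reprK -[y]reprK -quotalg_lin !DQ_pi DS_der.1.
exact: quotalg_lin.
Qed.

Lemma DQM x y : DQ (x * y) = DQ x * y + x * DQ y.
Proof.
rewrite -[x]reprK -[y]reprK -quotalgM !DQ_pi DS_der.2 -!quotalgM.
exact: (klinD (@quotalg_lin _ _ _)).
Qed.

Lemma DQ1 : DQ 1 = 0.
Proof. by rewrite -quotalg1 DQ_pi (der1 DS_der) (klin0 (@quotalg_lin _ _ _)).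
  Qed.

Lemma DQ_qDB n b : DQ (qDB n b) = qDB n.+1 b.
Proof. by rewrite /qDB DQ_pi DSE DCB_class. Qed.

Lemma iter_DQ n b : iter n DQ (qB b) = qDB n b.
Proof. by elim: n => //= n ->; rewrite DQ_qDB. Qed.

(** * Spanning by monomials in the [D^n b] *)

Let monoms n : set Q := [set x | exists s : seq (nat * B),
  [/\ s != [::], (\sum_(p <- s) p.1 + size s)%N = n
    & x = \prod_(p <- s) qDB p.1 p.2]].

Let sorted_monoms n : set Q := [set x | exists s : seq (nat * B),
  [/\ s != [::], sorted geq [seq p.1 | p <- s],
      (\sum_(p <- s) p.1 + size s)%N = n
    & x = \prod_(p <- s) iter p.1 DQ (qB p.2)]].

(** The product is commutative, so any monomial can be sorted; unsorted ones are easier to multiply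
    and derive. *)
Lemma sorted_monomsE n : sorted_monoms n = monoms n.
Proof.
have prodE (s : seq (nat * B)) :
    \prod_(p <- s) iter p.1 DQ (qB p.2) = \prod_(p <- s) qDB p.1 p.2.
  by apply: eq_bigr => p _; rewrite iter_DQ.
apply/seteqP; split=> x [s].
  by move=> [s0 _ sn ->]; exists s; rewrite prodE.
move=> [s0 sn ->]; pose r (p p' : nat * B) := geq p.1 p'.1.
have ss : perm_eq (sort r s) s by rewrite perm_sort.
exists (sort r s); split.
- by rewrite -size_eq0 size_sort size_eq0.
- rewrite sorted_map; apply: sort_sorted => p p'.
  by rewrite /r /= leq_total.
- by rewrite (perm_big _ ss) size_sort.
- by rewrite prodE (perm_big _ ss).
Qed.

Lemma lspan_monoms_mul d b n x : x \in lspan (monoms n) ->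
  qDB d b * x \in lspan (monoms (d + n).+1).
Proof.
apply: lspan_linear (quotalg_mul_linr _) _ _ => {}x [s [s0 <- ->]].
apply: lspan_gen; exists ((d, b) :: s); split => //; last by rewrite big_cons.
by rewrite big_cons /= addnS addnA.
Qed.

Lemma DQ_monom (s : seq (nat * B)) : DQ (\prod_(p <- s) qDB p.1 p.2) \in
  lspan (monoms (\sum_(p <- s) p.1 + size s).+1).
Proof.
(* The empty product is excluded from [monoms], but as [D 1 = 0] it is a legitimate start of the
   induction. *)
elim: s => [|[d b] s IHs]; first by rewrite big_nil DQ1 rpred0.
rewrite big_cons DQM DQ_qDB; apply: rpredD.
  apply: lspan_gen; exists ((d.+1, b) :: s); split => //;
    last by rewrite big_cons.
  by rewrite !big_cons.
by rewrite big_cons /= addnS -addnA -addnS; apply: lspan_monoms_mul.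
Qed.

Lemma DQ_monoms n x : x \in lspan (monoms n) -> DQ x \in lspan (monoms n.+1).
Proof.
apply: lspan_linear DQ_lin _ _ => {}x [s [_ <- ->]]; exact: DQ_monom.
Qed.

Lemma qDB_monoms n b : qDB n b \in lspan (monoms n.+1).
Proof.
apply: lspan_gen; exists [:: (n, b)].
by rewrite !big_seq1 addn1.
Qed.

Lemma qA_qDB n a b : qA a * qDB n b \in lspan (monoms n.+1).
Proof.
elim: n a b => [|n IHn] a b.
  by rewrite -[qDB 0 b]/(qB b) -quotAB; exact: (qDB_monoms 0).
have -> : qA a * qDB n.+1 b = DQ (qA a * qDB n b) - qDB 0 (cder B a) * qDB n b.
  by rewrite DQM DQ_qDB -quot_cder addrC addKr.
apply: rpredB; first exact/DQ_monoms/IHn.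
exact: (lspan_monoms_mul 0 _ (qDB_monoms n b)).
Qed.

Lemma lspan_monoms_mulr n x (s : seq (nat * B)) : x \in lspan (monoms n) ->
  x * \prod_(p <- s) qDB p.1 p.2 \in
    lspan (monoms (n + (\sum_(p <- s) p.1 + size s))).
Proof.
apply: lspan_linear (quotalg_mul_linl _) _ _ => {}x [t [t0 <- ->]].
apply: lspan_gen; exists (t ++ s); split; last by rewrite big_cat.
  by case: t t0.
by rewrite big_cat size_cat /= addnACA.
Qed.

(** The first factor of the monomial absorbs [a], at the price of becoming a combination of
    monomials of the same degree. *)
Lemma qA_monoms a (s : seq (nat * B)) : s != [::] ->
  qA a * \prod_(p <- s) qDB p.1 p.2 \in
    lspan (monoms (\sum_(p <- s) p.1 + size s)).
Proof.
case: s => // -[d b] s _; rewrite !big_cons mulrA /= addnS -addnA -addSn.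
exact/lspan_monoms_mulr/qA_qDB.
Qed.

(** * The graded pieces of the quotient *)

Let S_grade d : set S :=
  [set` lspan [set x | exists s : seq (nat * CB B),
    [/\ forall p, p \in s -> CB_grade p.1 p.2, (\sum_(p <- s) p.1)%N = d
      & x = \prod_(p <- s) inj p.2]]].
Let Q_grade d : set Q := [set q x | x in S_grade d].

Lemma CB_grade0 c : CB_grade 0 c -> exists a, c = classCB 0 (inA a).
Proof.
move=> [f /= Gf <-]; move: f Gf.
apply: (lspan_ind (P := fun f => exists a, \pi_(CB B) f = classCB 0 (inA a))).
  by exists 0; rewrite (klin0 (@inA_lin K A B)) (klin0 (class_lin 0)) pi_quot0.
move=> k x y [[a ->]|[n [b []//]]] [a' y'].
by exists (k *: a + a'); rewrite inA_lin class_lin piC_lin y'.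
Qed.

(** In [C] one has [D^(d+1) a = D^d (cder a)], so in positive degree the contribution of [A] is
    contained in that of [B]. *)
Lemma CB_gradeS d c : CB_grade d.+1 c -> exists b, c = classCB d (inB b).
Proof.
move=> [f /= Gf <-]; move: f Gf.
apply: (lspan_ind (P := fun f => exists b, \pi_(CB B) f = classCB d (inB b))).
  by exists 0; rewrite (klin0 (@inB_lin K A B)) (klin0 (class_lin d)) pi_quot0.
move=> k x y xE [b' y'];
  have [b xb] : exists b, \pi_(CB B) x = classCB d (inB b).
  case: xE => [[a ->]|[n [b [[->] ->]]]]; last by exists b.
  by exists (cder B a); rewrite class_cder.
exists (k *: (b : restr B) + b' : restr B).
by rewrite inB_lin class_lin piC_lin y' xb.
Qed.

Lemma CB_grade_inA a : CB_grade 0 (classCB 0 (inA a)).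
Proof.
by exists (dmon 0 (inA a)) => //=; apply: lspan_gen; left; exists a.
Qed.

Lemma CB_grade_inB d b : CB_grade d.+1 (classCB d (inB b)).
Proof.
by exists (dmon d (inB b)) => //=; apply: lspan_gen; right; exists d, b.
Qed.

(** The factors of degree 0 all come from [A] and multiply up, starting from [1], to a single [a];
    each factor of degree [d + 1] is some [D^d b]. *)
Lemma Q_grade_prod (s : seq (nat * CB B)) :
  (forall p, p \in s -> CB_grade p.1 p.2) ->
  exists a (t : seq (nat * B)),
    (\sum_(p <- t) p.1 + size t = \sum_(p <- s) p.1)%N /\
    q (\prod_(p <- s) inj p.2) = qA a * \prod_(p <- t) qDB p.1 p.2.
Proof.
elim: s => [|[d c] s IHs] sG.
  by exists 1, [::]; rewrite !big_nil quotA1 mulr1 quotalg1.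
have [|a [t [ts qst]]] := IHs; first by move=> p ps; apply: sG;
  rewrite inE ps orbT.
rewrite !big_cons quotalgM qst -ts /=.
have /= := sG (d, c); rewrite inE eqxx => /(_ isT).
case: d {sG} => [/CB_grade0[a' ->]|d /CB_gradeS[b ->]].
  by exists (a' * a), t; rewrite quotAM -mulrA.
exists a, ((d, b) :: t); split; first by rewrite big_cons /= addnS -addSn addnA.
by rewrite big_cons /= mulrCA.
Qed.

Lemma Q_grade_lspan d (F : set Q) :
  (forall a (t : seq (nat * B)), (\sum_(p <- t) p.1 + size t = d)%N ->
     qA a * \prod_(p <- t) qDB p.1 p.2 \in lspan F) ->
  forall x, Q_grade d x -> x \in lspan F.
Proof.
move=> FE _ [x /= Sx <-]; move: x Sx.
apply: (lspan_linear (f := q) (@quotalg_lin K S DE)) => _ [s [sG sd ->]].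
by have [a [t [ts ->]]] := Q_grade_prod sG; apply: FE; rewrite ts.
Qed.

Lemma Q_gradeE n : (1 <= n)%N -> Q_grade n = [set` lspan (sorted_monoms n)].
Proof.
move=> n0; rewrite sorted_monomsE; apply/seteqP; split=> x /=.
  apply: Q_grade_lspan => a t tn; rewrite -tn; apply: qA_monoms.
  by case: t tn => // tn; rewrite -tn big_nil in n0.
apply: (lspan_ind (P := fun x => Q_grade n x)).
  by exists 0; [exact: rpred0|rewrite pi_quot0].
move=> k _ _ [s [_ sn ->]] [y Sy <-].
exists (k *: (\prod_(p <- s) inj (classCB p.1 (inB p.2))) + y).
  apply: rpredD Sy; apply/rpredZ/lspan_gen.
  exists [seq (p.1.+1, classCB p.1 (inB p.2)) | p <- s]; split.
  - by move=> _ /mapP[p _ ->]; exact: CB_grade_inB.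
  - rewrite big_map -sn -sum1_size -big_split /=.
    by apply: eq_bigr => p _; rewrite addn1.
  - by rewrite big_map.
by rewrite quotalg_lin quotalg_prod.
Qed.

Lemma Q_grade0 x : Q_grade 0 x -> exists a, x = qA a.
Proof.
move=> Gx; have : x \in lspan (range qA).
  apply: Q_grade_lspan Gx => a t /eqP;
    rewrite addn_eq0 size_eq0 => /andP[_ /eqP->].
  by rewrite big_nil mulr1; apply: lspan_gen; exists a.
move: x {Gx}; apply: lspan_ind => [|k _ _ [a _ <-] [a' ->]].
  by exists 0; rewrite (klin0 quotA_lin).
by exists (k *: a + a'); rewrite quotA_lin.
Qed.

Lemma Q_grade1 x : Q_grade 1 x -> exists b, x = qB b.
Proof.
rewrite Q_gradeE // sorted_monomsE /=; move: x.
apply: lspan_ind => [|k _ _ [s [s0 s1 ->]] [b' ->]].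
  by exists 0; rewrite (klin0 quotB_lin).
have [b ->] : exists b, s = [:: (0, b)].
  case: s s0 s1 => // -[d b] [|p s] _; rewrite big_cons /= => /eqP.
    by rewrite addn1 eqSS addn_eq0 => /andP[/eqP-> _]; exists b.
  by rewrite !addnS.
exists (k *: (b : restr B) + b' : restr B).
by rewrite big_seq1 quotB_lin.
Qed.

Lemma Q_grade_qA a : Q_grade 0 (qA a).
Proof.
exists (SA a) => //; apply: lspan_gen; exists [:: (0, classCB 0 (inA a))].
rewrite !big_seq1; split=> // p; rewrite inE => /eqP ->; exact: CB_grade_inA.
Qed.

Lemma Q_grade_qB b : Q_grade 1 (qB b).
Proof.
exists (SB b) => //; apply: lspan_gen; exists [:: (1, classCB 0 (inB b))].
rewrite !big_seq1; split=> // p; rewrite inE => /eqP ->; exact: CB_grade_inB.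
Qed.

(** * Injectivity in degrees 0 and 1 *)

Variable F : S -> sqzero B.
Hypothesis F1 : F 1 = 1.
Hypothesis FM : forall x y, F (x * y) = F x * F y.
Hypothesis F_lin : forall k x y,
  F (k *: x + y) = sqzero_inl B (scalarA A k) * F x + F y.
Hypothesis FE : forall c, F (inj c) = CB_eval c.

Let F_comb k x y : F x = 0 -> F y = 0 -> F (k *: x + y) = 0.
Proof. by move=> x0 y0; rewrite F_lin x0 y0 mulr0 addr0. Qed.
Let FD x y : F (x + y) = F x + F y.
Proof. by rewrite -[x]scale1r F_lin !rmorph1 mul1r scale1r. Qed.
Let F0 : F 0 = 0.
Proof. by apply: (addrI (F 0)); rewrite -FD !addr0. Qed.
Let FB x y : F (x - y) = F x - F y.
Proof. by apply: (addIr (F y)); rewrite -FD !subrK. Qed.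

Let F_D x : F (DS x) = sqzero_der (F x).
Proof.
elim/S_ind: x => [|c x IHx|k x y IHx IHy].
- rewrite (der1 DS_der) F0 F1.
  by apply: injective_projections => //=; rewrite cder1.
- by rewrite DS_der.2 FD !FM sqzero_derM IHx DSE !FE CB_eval_D.
- by rewrite DS_der.1 !F_lin IHx IHy sqzero_der_lin.
Qed.

Let F_SA a : F (SA a) = sqzero_inl B a.
Proof. by rewrite FE CB_eval_class0. Qed.
Let F_SB (b : B) : F (SB b) = (0, b).
Proof. by rewrite FE CB_eval_class0. Qed.

Let F_E x : E x -> F x = 0.
Proof.
move=> [x0 E0x [x1 E1x <-]]; rewrite FD.
have -> : F x0 = 0.
  move: x0 E0x; apply: lspan_ind => [//|k _ y [->|[a [a' ->]]] Fy];
    apply: F_comb => //.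
    by rewrite FB F1 F_SA rmorph1 subrr.
  by rewrite FB FM !F_SA rmorphM subrr.
have -> : F x1 = 0; last exact: addr0.
move: x1 E1x; apply: lspan_ind => [//|k _ y [a [b ->]] Fy]; apply: F_comb => //.
rewrite FB FM F_SA !F_SB; apply/eqP; rewrite subr_eq0; apply/eqP.
by apply: injective_projections; rewrite /= ?mulr0// scale0r addr0.
Qed.

(** Since [F] restricts to the two inclusions on [A] and [B], an element of either can be recovered
    from its class. *)
Let F_quot x y : q x = q y -> F x = F y.
Proof.
move=> /quotalg_eqP xy; apply/eqP; rewrite -subr_eq0 -FB; apply/eqP.
move: xy; move: (x - y) => {y};
  apply: lspan_ind => [//|k _ z [y _ [t DEt <-]] Fz].
apply: F_comb => //; rewrite FM; have -> : F t = 0; last exact: mulr0.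
move: t DEt => /=; apply: lspan_ind => [//|l _ t [m [e [Ee ->]]] Ft].
apply: F_comb => //; elim: m => [|m IHm] /=; first exact: F_E.
by rewrite F_D IHm; apply: injective_projections => //=;
  rewrite (klin0 (cder_klin B)).
Qed.

Lemma Q_grade0_bij : set_bij [set: A] (Q_grade 0) qA.
Proof.
split=> [a _|a a' _ _ /F_quot|x /Q_grade0[a ->]]; first exact: Q_grade_qA.
  by rewrite !F_SA => -[].
by exists a.
Qed.

Lemma Q_grade1_bij : set_bij [set: B] (Q_grade 1) qB.
Proof.
split=> [b _|b b' _ _ /F_quot|x /Q_grade1[b ->]]; first exact: Q_grade_qB.
  by rewrite !F_SB => -[].
by exists b.
Qed.

Lemma quotA_isom : [/\ set_bij [set: A] (Q_grade 0) qA,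
  forall (k : K) a a', qA (k *: a + a') = k *: qA a + qA a', qA 1 = 1
  & forall a a', qA (a * a') = qA a * qA a'].
Proof.
split; [exact: Q_grade0_bij|exact: quotA_lin|exact: quotA1|exact: quotAM].
Qed.

Lemma quotB_isom :
  [/\ set_bij [set: B] (Q_grade 1) qB,
    forall (k : K) (u v : B), qB ((k *: (1 : A)) *: u + v) = k *: qB u + qB v
  & forall a (u : B), qB (a *: u) = qA a * qB u] /\
  [/\ forall u v : B, qB (bracket u v) = PQ 0 (qB u) (qB v),
      forall u v : B, qA (pairing u v) = PQ 1 (qB u) (qB v),
      forall (u : B) a, qA (anchor u a) = PQ 0 (qB u) (qA a)
    & forall a, qB (cder B a) = DQ (qA a)].
Proof.
split; split.
- exact: Q_grade1_bij.
- exact: quotB_lin.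
- exact: quotAB.
- exact: quot_bracket.
- exact: quot_pairing.
- exact: quot_anchor.
- exact: quot_cder.
Qed.
End CourantQuotient.

(** * Application to the symmetric algebra [S(C)] *)

Section CourantVertexPoisson.
Variables (K : fieldType) (A : comPzAlg K) (B : courant A).
Hypothesis pcharK : [pchar K] =i pred0.
Notation S := (symalg (CB B)).

Let inj_lin : klinear (@sym_inj K (CB B)) := @sym_inj_lin K (CB B).
Let S_ind := @sym_ind K (CB B).

Let D_lin : klinear (fun u => sym_inj (@DCB K A B u)).
Proof. by move=> k u v; rewrite DCB_lin sym_inj_lin. Qed.

Let Y_lin n u : klinear (fun v => sym_inj (@prodCB K A B n u v)).
Proof. by move=> k v w; rewrite prodCB_linr // sym_inj_lin. Qed.

Let DS_der : derivation (@DSC K A B : S -> S).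
Proof. exact: (der_ext_der D_lin). Qed.

Let DSE u : DSC (sym_inj u) = sym_inj (@DCB K A B u).
Proof. exact: (der_extE u D_lin). Qed.

Let Z_der u n : derivation (@Yt K A B u n : S -> S).
Proof. exact: (der_ext_der (Y_lin n u)). Qed.

Let ZE u n v : Yt u n (sym_inj v) = sym_inj (@prodCB K A B n u v).
Proof. exact: (der_extE v (Y_lin n u)). Qed.

Let P_lin n (a : S) : klinear (skew_prod (@DSC K A B : S -> S) (@Yt K A B) n a).
Proof.
exact: (skew_prod_linr inj_lin S_ind (@prodCB_linl _ _ _ pcharK)
  (prodCB_fin pcharK) DS_der Z_der ZE).
Qed.

Let P_der n a : derivation (@prodSC K A B n a : S -> S).
Proof. exact: (der_ext_der (P_lin n a)). Qed.

Let PE n a u : prodSC n a (sym_inj u) =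
  skew_prod (@DSC K A B : S -> S) (@Yt K A B) n a u.
Proof. exact: (der_extE u (P_lin n a)). Qed.

Lemma SC_eval : exists F : S -> sqzero B, [/\ F 1 = 1,
  forall x y, F (x * y) = F x * F y,
  forall k x y, F (k *: x + y) = sqzero_inl B (scalarA A k) * F x + F y
  & forall c, F (sym_inj c) = CB_eval c].
Proof. exact: (sym_lift (i := sqzero_inl B \o scalarA A) (@CB_eval_lin K A B)).
  Qed.

Lemma natA_isom : natA_alg_isom B.
Proof.
have [F [F1 FM FD FE]] := SC_eval.
exact (quotA_isom inj_lin S_ind DS_der DSE F1 FM FD FE).
Qed.

Lemma natB_isom : natB_courant_isom B.
Proof.
have [F [F1 FM FD FE]] := SC_eval.
exact (quotB_isom pcharK inj_lin S_ind DS_der DSE Z_der ZE P_der PE F1 FM FD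
  FE).
Qed.

Lemma SCB_gradeE n : (1 <= n)%N -> (SCB_grade n : set (SCB B)) =
  [set` lspan [set x : SCB B | exists s : seq (nat * B),
    [/\ s != [::], sorted geq [seq p.1 | p <- s],
        (\sum_(p <- s) p.1 + size s)%N = n
      & x = \prod_(p <- s) iter p.1 (@DSCB _ _ B) (natB p.2)]]].
Proof. by move=> n0; exact (Q_gradeE DS_der DSE n0). Qed.
End CourantVertexPoisson.

Local Open Scope complex_scope.

Theorem theorem5p3 (R : realType) (A : comPzAlg R[i]) (B : courant A) :
  [/\ natA_alg_isom B,
      natB_courant_isom B
    & forall n : nat, (1 <= n)%N ->
        (SCB_grade n : set (SCB B)) =
        [set` lspan [set x : SCB B | exists s : seq (nat * B),
          [/\ s != [::],
              sorted geq [seq p.1 | p <- s],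
              (\sum_(p <- s) p.1 + size s)%N = n
            & x = \prod_(p <- s) iter p.1 (@DSCB _ _ B) (natB p.2)]]]].
Proof.
have pcharC : [pchar R[i]] =i pred0 := @Num.Theory.pchar_num R[i].
split; [exact: natA_isom|exact: natB_isom|exact: SCB_gradeE].
Qed.
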